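(* Let $\mathfrak L=L_{\boldsymbol m}(\mathfrak g,\boldsymbol\sigma,\mathfrak h)$ and $\mathfrak L'=L_{\boldsymbol m'}(\mathfrak g',\boldsymbol\sigma',\mathfrak h')$ be multiloop Lie algebras of nullity $n$ with $\mathfrak g^{\boldsymbol\sigma}\ne\{0\}$ and $\mathfrak g'^{\boldsymbol\sigma'}\ne\{0\}$. If $E(\mathfrak L,\mathfrak D,\tau)$ is isomorphic as EALAs to $E(\mathfrak L',\mathfrak D',\tau')$ for some $(\mathfrak D,\tau)\in\mathcal P(\mathfrak L)$ and $(\mathfrak D',\tau')\in\mathcal P(\mathfrak L')$, then $\mathfrak L$ and $\mathfrak L'$ are support-isomorphic.
   Context: $k$ is algebraically closed of characteristic $0$; fixed roots of unity $\zeta_n$ with $\zeta_{mn}^m=\zeta_n$. Multiloop Lie algebra: $\mathfrak g$ finite-dimensional simple over $k$, $\boldsymbol\sigma=(\sigma_1,\dots,\sigma_n)$ pairwise commuting finite-order automorphisms, $\boldsymbol m\in\mathbb Z^n_{>0}$ with $\sigma_i^{m_i}=\mathrm{id}$; $\mathfrak g^{\bar\lambda}=\{g:\sigma_i(g)=\zeta_{m_i}^{l_i}g\ \forall i\}$ for $\lambda=(l_1,\dots,l_n)\in\mathbb Z^n$, $\mathfrak g^{\boldsymbol\sigma}=\mathfrak g^{\bar0}$; when $\mathfrak g^{\boldsymbol\sigma}\ne0$, $\mathfrak h$ is a Cartan subalgebra of $\mathfrak g^{\boldsymbol\sigma}$, acting diagonalizably on $\mathfrak g$ with root spaces $\mathfrak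 g_\alpha$; $Q_{\mathfrak h}$ is generated by the nonzero weights; $L_{\boldsymbol m}(\mathfrak g,\boldsymbol\sigma,\mathfrak h)=\bigoplus_{(\alpha,\lambda)\in Q_{\mathfrak h}\times\mathbb Z^n}(\mathfrak g_\alpha\cap\mathfrak g^{\bar\lambda})\otimes t^\lambda\subseteq\mathfrak g\otimes k[t_1^{\pm1},\dots,t_n^{\pm1}]$, $Q_{\mathfrak h}\times\mathbb Z^n$-graded; $\mathfrak L^\lambda=\mathfrak g^{\bar\lambda}\otimes t^\lambda$. Support-isomorphic: there are a Lie algebra isomorphism $\varphi:\mathfrak L\to\mathfrak L'$ and a group isomorphism $\varphi_{\mathrm{su}}$ from the subgroup generated by $\{(\alpha,\lambda):\mathfrak L^\lambda_\alpha\ne0\}$ onto the analogous subgroup for $\mathfrak L'$ with $\varphi(\mathfrak L^\lambda_\alpha)=\mathfrak L'^{\lambda'}_{\alpha'}$ where $(\alpha',\lambda')=\varphi_{\mathrm{su}}(\alpha,\lambda)$. Bilinear form on $\mathfrak L$: $(x\otimes t^\lambda|y\otimes t^\mu)=\kappa(x,y)$ if $\lambda+\mu=0$ and $0$ otherwise, $\kappa$ the Killing form of $\mathfrak g$. Construction: $\mathfrak L$ is $\mathbb Z^n$-graded. Its centroid $C(\mathfrak L)$ (linear endomorphisms commuting with all $\mathrm{ad}\,x$) is graded by $C(\mathfrak L)^\mu=\{c:c\mathfrak L^\nu\subseteq\mathfrak L^{\mu+\nu}\ \forall\nu\}$; $\Gamma=\{\mu:C(\mathfrak L)^\mu\ne0\}$.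 For $\theta\in\mathrm{Hom}(\mathbb Z^n,k)$, $\partial_\theta(x)=\theta(\lambda)x$ for $x\in\mathfrak L^\lambda$. $\mathrm{SCDer}(\mathfrak L)=\bigoplus_{\mu\in\Gamma}C(\mathfrak L)^\mu\cdot\{\partial_\theta:\theta(\mu)=0\}$. $\mathcal P(\mathfrak L)$ is the set of pairs $(\mathfrak D,\tau)$ where: $\mathfrak D=\bigoplus_{\mu\in\Gamma}\mathfrak D^\mu$ is a $\Gamma$-graded subalgebra of $\mathrm{SCDer}(\mathfrak L)$ such that $\mathrm{ev}:\mathbb Z^n\to(\mathfrak D^0)^*$, $\mathrm{ev}(\lambda)(\partial_\theta)=\theta(\lambda)$, is injective; with $\mathfrak C=\bigoplus_{\mu\in\Gamma}(\mathfrak D^\mu)^*$, graded by $\mathfrak C^\mu=(\mathfrak D^{-\mu})^*$ and a $\mathfrak D$-module via $(d\cdot c)(d')=-c([d,d'])$, $\tau:\mathfrak D\times\mathfrak D\to\mathfrak C$ is a Lie algebra 2-cocycle with values in $\mathfrak C$ which is graded ($\tau(\mathfrak D^{\mu_1},\mathfrak D^{\mu_2})\subseteq\mathfrak C^{\mu_1+\mu_2}$), invariant ($\tau(d_1,d_2)(d_3)=\tau(d_2,d_3)(d_1)$), with $\tau(\mathfrak D,\mathfrak D^0)=0$. Then $E(\mathfrak L,\mathfrak D,\tau)=\mathfrak L\oplus\mathfrak C\oplus\mathfrak D$ with bracket $[x_1+c_1+d_1,x_2+c_2+d_2]=([x_1,x_2]+d_1(x_2)-d_2(x_1))+(\sigma_{\mathfrak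 D}(x_1,x_2)+d_1\cdot c_2-d_2\cdot c_1+\tau(d_1,d_2))+[d_1,d_2]$, $\sigma_{\mathfrak D}(x,y)(d)=(d(x)|y)$, form $(x_1+c_1+d_1|x_2+c_2+d_2)=(x_1|x_2)+d_1(c_2)+d_2(c_1)$, and subalgebra $H=\mathfrak h\oplus\mathfrak C^0\oplus\mathfrak D^0$ (an EALA). EALA isomorphism: $(E,H,(\cdot|\cdot))$, $(E',H',(\cdot|\cdot)')$ are isomorphic if there is a Lie algebra isomorphism $\chi:E\to E'$ with $\chi(H)=H'$ and $(\chi(x)|\chi(y))'=a(x|y)$ for some $a\in k$. *)

(* Defs.v *)
From HB Require Import structures.
From mathcomp Require Import all_boot all_order all_algebra all_field.
From mathcomp Require Import boolp classical_sets functions.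
From Stdlib Require List.
Set Implicit Arguments. Unset Strict Implicit. Unset Printing Implicit Defensive.
Import GRing.Theory.
Local Open Scope ring_scope.

Section LieBasics.
Variables (k : fieldType) (g : vectType k) (br : g -> g -> g).

Definition is_lie : Prop :=
  [/\ forall a x y z, br (a *: x + y) z = a *: br x z + br y z,
      forall a x y z, br x (a *: y + z) = a *: br x y + br x z,
      forall x, br x x = 0 &
      forall x y z, br x (br y z) + br y (br z x) + br z (br x y) = 0].

Definition lie_ideal (I : {vspace g}) : Prop :=
  forall x y, y \in I -> br x y \in I.

Definition simple_lie : Prop :=
  (exists x y, br x y != 0) /\
  forall I, lie_ideal I -> I = 0%VS \/ I = fullv.

Definition lie_aut (s : g -> g) : Prop :=
  [/\ forall a x y, s (a *: x + y) = a *: s x + s y,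
      bijective s &
      forall x y, s (br x y) = br (s x) (s y)].

Definition killing (x y : g) : k :=
  \tr (passmx.mxof (vbasis fullv) (vbasis fullv) (linfun (fun z => br x (br y z)))).

Definition cartan_in (F : g -> Prop) (h : {vspace g}) : Prop :=
  [/\ forall x, x \in h -> F x,
      forall x y, x \in h -> y \in h -> br x y \in h,
      exists N : nat, forall (xs : seq g) (y : g),
          size xs = N -> all (fun x => x \in h) xs -> y \in h ->
          foldr br y xs = 0 &
      forall x, F x -> (forall y, y \in h -> br x y \in h) -> x \in h].
End LieBasics.

Record mlData (k : fieldType) (n : nat) := MLData {
  ml_g : vectType k;
  ml_br : ml_g -> ml_g -> ml_g;
  ml_sigma : 'I_n -> ml_g -> ml_g;
  ml_m : 'I_n -> nat;
  ml_h : {vspace ml_g} }.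
Arguments ml_g {k n} m.
Arguments ml_br {k n} m _ _.
Arguments ml_sigma {k n} m _ _.
Arguments ml_m {k n} m _.
Arguments ml_h {k n} m.

Section Multiloop.
Variables (k : fieldType) (zeta : nat -> k) (n : nat) (M : mlData k n).

Local Notation g := (ml_g M).
Local Notation br := (ml_br M).
Local Notation sigma := (ml_sigma M).
Local Notation m := (ml_m M).
Local Notation h := (ml_h M).
Local Notation Zn := 'rV[int]_n.

Definition fixed_all (x : g) : Prop := forall i, sigma i x = x.

Definition is_mlData : Prop :=
  [/\ is_lie br /\ simple_lie br,
      forall i, lie_aut br (sigma i),
      forall i j, sigma i \o sigma j =1 sigma j \o sigma i,
      (forall i, (0 < m i)%N) /\ (forall i, iter (m i) (sigma i) =1 id) &
      cartan_in br fixed_all h].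

Definition eigsp (l : Zn) (x : g) : Prop :=
  forall i, sigma i x = (zeta (m i)) ^ (l 0 i) *: x.

(* elements of g (x) k[t_1^{+-1},...,t_n^{+-1}] : finitely supported maps Z^n -> g *)
Definition LT := Zn -> g.
Definition EndL := LT -> LT.

Definition fin_supp (x : LT) : Prop :=
  exists s : seq Zn, forall l, l \notin s -> x l = 0.

(* membership in L = sum_lambda g^{\bar lambda} (x) t^lambda *)
Definition inL (x : LT) : Prop := fin_supp x /\ forall l, eigsp l (x l).

Definition suppL (x : LT) : seq Zn :=
  xget [::] [set s : seq Zn | uniq s /\ forall l, l \notin s -> x l = 0].

(* bracket [x (x) t^l, y (x) t^mu] = [x,y] (x) t^(l+mu), extended bilinearly *)
Definition brL (x y : LT) : LT :=
  fun nu => \sum_(l <- suppL x) br (x l) (y (nu - l)).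

(* invariant form (x (x) t^l | y (x) t^mu) = kappa(x,y) [l + mu = 0] *)
Definition formL (x y : LT) : k :=
  \sum_(l <- suppL x) killing br (x l) (y (- l)).

Definition homL (l : Zn) (x : LT) : Prop :=
  inL x /\ forall l', l' != l -> x l' = 0.

(* weights: linear forms on h, written in the basis vbasis h *)
Definition weight := 'rV[k]_(\dim h).

Definition rootsp (a : weight) (v : g) : Prop :=
  forall i, br (tnth (vbasis h) i) v = a 0 i *: v.

Definition Lroot (p : weight * Zn) (x : LT) : Prop :=
  homL p.2 x /\ rootsp p.1 (x p.2).

Definition supportL (p : weight * Zn) : Prop :=
  exists x, Lroot p x /\ x <> 0.

Definition centroid (c : EndL) : Prop :=
  [/\ forall x, ~ inL x -> c x = 0,
      forall x, inL x -> inL (c x),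
      forall a x y, inL x -> inL y -> c (a *: x + y) = a *: c x + c y &
      forall x y, inL x -> inL y -> c (brL x y) = brL x (c y)].

Definition centroid_mu (mu : Zn) (c : EndL) : Prop :=
  centroid c /\ forall nu x, homL nu x -> homL (mu + nu) (c x).

Definition GammaL (mu : Zn) : Prop := exists c, centroid_mu mu c /\ c <> 0.

(* theta in Hom(Z^n, k), given by its values on the standard basis *)
Definition thv (th : 'rV[k]_n) (l : Zn) : k := \sum_i th 0 i * (l 0 i)%:~R.

Definition dtheta (th : 'rV[k]_n) : EndL :=
  fun x => if `[< inL x >] then (fun l => thv th l *: x l) else 0.

Definition lin_span (V : lmodType k) (P : V -> Prop) (v : V) : Prop :=
  exists s : seq (k * V), (forall p, List.In p s -> P p.2) /\
                          v = \sum_(p <- s) p.1 *: p.2.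

Definition SCDer_mu (mu : Zn) (d : EndL) : Prop :=
  lin_span (fun e : EndL => exists c th, [/\ centroid_mu mu c, thv th mu = 0 &
                                              e = c \o dtheta th]) d.

Definition SCDer (d : EndL) : Prop :=
  exists s : seq (Zn * EndL),
    (forall p, List.In p s -> GammaL p.1 /\ SCDer_mu p.1 p.2) /\
    d = \sum_(p <- s) p.2.

Definition commE (d1 d2 : EndL) : EndL := fun x => d1 (d2 x) - d2 (d1 x).

Section PL.
Variable D : EndL -> Prop.

Definition Dmu (mu : Zn) (d : EndL) : Prop := D d /\ SCDer_mu mu d.

Definition graded_subalg : Prop :=
  [/\ D 0,
      forall a d1 d2, D d1 -> D d2 -> D (a *: d1 + d2),
      forall d, D d -> SCDer d,
      forall d1 d2, D d1 -> D d2 -> D (commE d1 d2) &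
      forall d, D d -> exists s : seq (Zn * EndL),
          (forall p, List.In p s -> GammaL p.1 /\ Dmu p.1 p.2) /\
          d = \sum_(p <- s) p.2].

(* ev : Z^n -> (D^0)^*, ev(lambda)(d_theta) = theta(lambda), is injective *)
Definition ev_inj : Prop :=
  forall l : Zn, (forall th, Dmu 0 (dtheta th) -> thv th l = 0) -> l = 0.

(* C = (+)_mu (D^mu)^*, realised as the linear forms on D (extended by 0
   outside D) vanishing on all but finitely many D^mu *)
Definition inC (c : EndL -> k) : Prop :=
  [/\ forall d, ~ D d -> c d = 0,
      forall a d1 d2, D d1 -> D d2 -> c (a *: d1 + d2) = a * c d1 + c d2 &
      exists s : seq Zn, forall mu d, mu \notin s -> Dmu mu d -> c d = 0].

(* C^mu = (D^{-mu})^* *)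
Definition Cmu (mu : Zn) (c : EndL -> k) : Prop :=
  inC c /\ forall nu d, nu != - mu -> Dmu nu d -> c d = 0.

Definition actC (d : EndL) (c : EndL -> k) : EndL -> k :=
  fun d' => if `[< D d' >] then - c (commE d d') else 0.

Definition is_cocycle (tau : EndL -> EndL -> EndL -> k) : Prop :=
  [/\ forall d1 d2, D d1 -> D d2 -> inC (tau d1 d2),
      forall a d1 d2 d3, D d1 -> D d2 -> D d3 ->
          tau (a *: d1 + d2) d3 = (fun e => a * tau d1 d3 e + tau d2 d3 e),
      forall d, D d -> tau d d = 0 &
      forall d1 d2 d3, D d1 -> D d2 -> D d3 ->
          actC d1 (tau d2 d3) - actC d2 (tau d1 d3) + actC d3 (tau d1 d2)
          - tau (commE d1 d2) d3 + tau (commE d1 d3) d2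
          - tau (commE d2 d3) d1 = 0].

Definition inPL (tau : EndL -> EndL -> EndL -> k) : Prop :=
  [/\ graded_subalg /\ ev_inj, is_cocycle tau,
      forall mu1 mu2 d1 d2, Dmu mu1 d1 -> Dmu mu2 d2 -> Cmu (mu1 + mu2) (tau d1 d2),
      forall d1 d2 d3, D d1 -> D d2 -> D d3 -> tau d1 d2 d3 = tau d2 d3 d1 &
      forall d d0, D d -> Dmu 0 d0 -> tau d d0 = 0].

Definition ET := (LT * (EndL -> k) * EndL)%type.

Definition inE (e : ET) : Prop := [/\ inL e.1.1, inC e.1.2 & D e.2].

Definition addE (e1 e2 : ET) : ET :=
  ((e1.1.1 + e2.1.1, fun d => e1.1.2 d + e2.1.2 d), e1.2 + e2.2).

Definition scaleE (a : k) (e : ET) : ET :=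
  ((a *: e.1.1, fun d => a * e.1.2 d), a *: e.2).

Definition sigmaD (x y : LT) : EndL -> k :=
  fun d => if `[< D d >] then formL (d x) y else 0.

Definition brE (tau : EndL -> EndL -> EndL -> k) (e1 e2 : ET) : ET :=
  let: ((x1, c1), d1) := e1 in let: ((x2, c2), d2) := e2 in
  ((brL x1 x2 + d1 x2 - d2 x1,
    sigmaD x1 x2 + actC d1 c2 - actC d2 c1 + tau d1 d2),
   commE d1 d2).

Definition formE (e1 e2 : ET) : k :=
  let: ((x1, c1), d1) := e1 in let: ((x2, c2), d2) := e2 in
  formL x1 x2 + c2 d1 + c1 d2.

Definition inH (e : ET) : Prop :=
  [/\ e.1.1 0 \in h /\ (forall l, l != 0 -> e.1.1 l = 0),
      Cmu 0 e.1.2 & Dmu 0 e.2].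
End PL.
End Multiloop.

Definition gen_subgroup (T : zmodType) (A : T -> Prop) (x : T) : Prop :=
  exists s : seq (T * int), (forall p, List.In p s -> A p.1) /\
                            x = \sum_(p <- s) p.1 *~ p.2.

Definition eala_iso (k : fieldType) (zeta : nat -> k) (n : nat)
    (M : mlData k n) (D : EndL M -> Prop) (tau : EndL M -> EndL M -> EndL M -> k)
    (M' : mlData k n) (D' : EndL M' -> Prop) (tau' : EndL M' -> EndL M' -> EndL M' -> k) :
    Prop :=
  exists chi : ET M -> ET M',
  [/\ (forall e, inE zeta D e -> inE zeta D' (chi e)) /\
      (forall a e1 e2, inE zeta D e1 -> inE zeta D e2 ->
         chi (addE (scaleE a e1) e2) = addE (scaleE a (chi e1)) (chi e2)),
      forall e1 e2, inE zeta D e1 -> inE zeta D e2 ->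
         chi (brE D tau e1 e2) = brE D' tau' (chi e1) (chi e2),
      (forall e1 e2, inE zeta D e1 -> inE zeta D e2 -> chi e1 = chi e2 -> e1 = e2) /\
      (forall e', inE zeta D' e' -> exists e, inE zeta D e /\ chi e = e'),
      (forall e, inH zeta D e -> inH zeta D' (chi e)) /\
      (forall e', inH zeta D' e' -> exists e, inH zeta D e /\ chi e = e') &
      exists a : k, forall e1 e2, inE zeta D e1 -> inE zeta D e2 ->
         formE (chi e1) (chi e2) = a * formE e1 e2].

Definition support_iso (k : fieldType) (zeta : nat -> k) (n : nat)
    (M M' : mlData k n) : Prop :=
  exists (phi : LT M -> LT M') (phisu : weight M * 'rV[int]_n -> weight M' * 'rV[int]_n),
  [/\
      [/\ forall x, inL zeta x -> inL zeta (phi x),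
          forall a x y, inL zeta x -> inL zeta y -> phi (a *: x + y) = a *: phi x + phi y,
          forall x y, inL zeta x -> inL zeta y -> phi (brL x y) = brL (phi x) (phi y),
          forall x y, inL zeta x -> inL zeta y -> phi x = phi y -> x = y &
          forall y, inL zeta y -> exists x, inL zeta x /\ phi x = y],
      [/\ forall p q, gen_subgroup (supportL zeta (M := M)) p ->
                      gen_subgroup (supportL zeta (M := M)) q -> phisu (p + q) = phisu p + phisu q,
          forall p, gen_subgroup (supportL zeta (M := M)) p ->
                    gen_subgroup (supportL zeta (M := M')) (phisu p),
          forall p q, gen_subgroup (supportL zeta (M := M)) p ->
                      gen_subgroup (supportL zeta (M := M)) q -> phisu p = phisu q -> p = q &
          forall p', gen_subgroup (supportL zeta (M := M')) p' ->
                     exists p, gen_subgroup (supportL zeta (M := M)) p /\ phisu p = p'] &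
      forall p, gen_subgroup (supportL zeta (M := M)) p ->
        (forall x, Lroot zeta p x -> Lroot zeta (phisu p) (phi x)) /\
        (forall y, Lroot zeta (phisu p) y -> exists x, Lroot zeta p x /\ phi x = y)].

(* Main.v *)
Require Import Defs.
From HB Require Import structures.
From mathcomp Require Import all_boot all_order all_algebra all_field.
From mathcomp Require Import boolp classical_sets functions.
Import GRing.Theory.
Local Open Scope ring_scope.

(* Write E = L + C + D.  Since L is graded simple, no nonzero derivation in SCDer
   is inner and the degree derivations in D^0 separate Z^n, every ideal J of E
   not contained in C satisfies J + C >= L + C.  Hence C is the largest abelian
   ideal of E and L + C is the smallest ideal properly containing C, so every Lie
   isomorphism chi : E -> E' induces an isomorphism L = (L + C)/C -> L'.
   Because C(L)^0 = k, the algebra H acts on L through h and the derivations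
   d_theta in D^0, and the spaces L_alpha^lambda are exactly its joint
   eigenspaces; as chi(H) = H', they are matched by the isomorphism, and the map
   on supports is transport of linear forms from H to H'. *)
Set Implicit Arguments. Unset Strict Implicit. Unset Printing Implicit Defensive.

(** The obstacle is that [L] is only graded simple: multiplication by [t^(N mu)], with [N] the
    product of the [m_i], preserves [L] and commutes with brackets, so [L] has in general many
    non-graded ideals. Injectivity of [ev] removes them: an ideal of [E] induces an ideal of [L]
    stable under enough [d_theta] to isolate a single homogeneous component. The same
    multiplications separate inner derivations from [SCDer], and they let [d_theta] determine
    [theta] even at degrees where [L] vanishes. Since [L] sits inside the space of all functions
    from [Z^n] to [g], subspaces are predicates closed under linear combinations, and most
    statements about [L] are proved by showing that such a predicate holds on monomials, or is an
    ideal containing a nonzero one. *)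

(** * Subspaces given as predicates *)

Definition lin_closed (k : fieldType) (V : lmodType k) (P : V -> Prop) : Prop :=
  P 0 /\ forall a u v, P u -> P v -> P (a *: u + v).

Section LinClosed.
Variables (k : fieldType) (V : lmodType k) (P : V -> Prop) (PL : lin_closed P).

Lemma lin_closedD u v : P u -> P v -> P (u + v).
Proof. by move=> Pu Pv; have := PL.2 1 u v Pu Pv; rewrite scale1r. Qed.

Lemma lin_closedZ a u : P u -> P (a *: u).
Proof. by move=> Pu; have := PL.2 a u 0 Pu PL.1; rewrite addr0. Qed.

Lemma lin_closed_sum (I : Type) (s : seq I) (F : I -> V) :
  (forall i, P (F i)) -> P (\sum_(i <- s) F i).
Proof. by move=> PF; elim/big_ind: _ => //; [exact: PL.1 | exact: lin_closedD]. Qed.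
End LinClosed.

(** Take a subspace of maximal dimension contained in [P]; adjoining the line of any further vector
    of [P] cannot enlarge it. *)
Lemma lin_closed_vspace (k : fieldType) (V : vectType k) (P : V -> Prop) :
  lin_closed P -> exists U : {vspace V}, forall v, v \in U <-> P v.
Proof.
move=> PL.
pose Q d := `[< exists U : {vspace V}, \dim U = d /\ forall v, v \in U -> P v >].
have Q0 : exists d, Q d.
  exists 0%N; apply/asboolP; exists 0%VS; rewrite dimv0; split=> // v.
  by rewrite memv0 => /eqP ->; exact: PL.1.
have Qb d : Q d -> (d <= \dim {: V})%N.
  by move=> /asboolP[U [<- _]]; apply/dimvS/subvf.
case: (ex_maxnP Q0 Qb) => d /asboolP[U [dU UP]] dmax.
exists U => v; split; first exact: UP.
move=> Pv; have : Q (\dim (U + <[v]>)).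
  apply/asboolP; exists (U + <[v]>)%VS; split=> // w /memv_addP[u Uu [x /vlineP[a ->] ->]].
  by apply: lin_closedD => //; [exact: UP | exact: lin_closedZ].
move=> /dmax; rewrite -dU => le_dim.
have /eqP -> : (U == U + <[v]>)%VS by rewrite -(geq_leqif (dimv_leqif_eq (addvSl U _))).
by apply: (subvP (addvSr U <[v]>)); exact: memv_line.
Qed.

(** As [f] is linear only on [P], it is replaced by its matrix in a basis of [P]. [P] being nonzero,
    the characteristic polynomial is not constant, so it has a root. This feeds the Schur argument
    for the centroid. *)
Lemma eigenvector_exists (k : closedFieldType) (V : vectType k) (P : V -> Prop)
    (f : V -> V) :
  lin_closed P -> (forall v, P v -> P (f v)) ->
  (forall a u v, P u -> P v -> f (a *: u + v) = a *: f u + f v) ->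
  (exists v, P v /\ v != 0) ->
  exists a v, [/\ P v, v != 0 & f v = a *: v].
Proof.
move=> PL Pf fL [v0 [Pv0 v0n0]]; have [U UP] := lin_closed_vspace PL.
have f0 : f 0 = 0.
  have := fL (-1) 0 0 PL.1 PL.1.
  by rewrite scaler0 addr0 => {1}->; rewrite scaleN1r addNr.
pose b := vbasis U; have bU i : P (tnth b i) by apply/UP/vbasis_mem/mem_tnth.
pose A : 'M[k]_(\dim U) := \matrix_(i, j) coord b j (f (tnth b i)).
have dim_gt0 : (0 < \dim U)%N.
  rewrite lt0n dimv_eq0; apply: contra_neq v0n0 => U0.
  by move/UP: Pv0; rewrite U0 memv0 => /eqP.
have /closed_rootP [a rAa] : size (char_poly A) != 1%N.
  by rewrite size_char_poly eqSS -lt0n.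
move: rAa; rewrite -eigenvalue_root_char => /eigenvalueP[u uA un0].
have fb i : f (tnth b i) = \sum_j A i j *: tnth b j.
  rewrite {1}(coord_vbasis (proj2 (UP _) (Pf _ (bU i)))).
  by apply: eq_bigr => j _; rewrite mxE -tnth_nth.
have fsum (s : seq 'I_(\dim U)) :
    f (\sum_(i <- s) u 0 i *: tnth b i) = \sum_(i <- s) u 0 i *: f (tnth b i).
  elim: s => [|i s IH]; first by rewrite !big_nil.
  have Pb j : P (u 0 j *: tnth b j) by exact: lin_closedZ.
  rewrite !big_cons fL ?IH //. exact: (lin_closed_sum PL).
exists a, (\sum_i u 0 i *: tnth b i); split.
- by apply: lin_closed_sum => // i; exact: lin_closedZ.
- apply: contra_neq un0 => e; apply/rowP => i; rewrite mxE.
  have /freeP fr := basis_free (vbasisP U).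
  have e' : \sum_i u 0 i *: b`_i = 0.
    by rewrite -[RHS]e; apply: eq_bigr => j _; rewrite -tnth_nth.
  exact: fr e' i.
- rewrite fsum; under eq_bigr => i _ do rewrite fb scaler_sumr.
  rewrite exchange_big /= scaler_sumr; apply: eq_bigr => j _.
  rewrite scalerA; have := congr1 (fun v : 'rV_ _ => v 0 j) uA; rewrite !mxE => <-.
  by rewrite scaler_suml; apply: eq_bigr => i _; rewrite scalerA.
Qed.

(** * Eigenprojections of an operator of finite order *)

Section EigProj.
Variables (k : fieldType) (V : lmodType k) (s : V -> V) (m : nat).
Hypotheses (sL : forall a u v, s (a *: u + v) = a *: s u + s v)
           (m_gt0 : (0 < m)%N) (s_m : iter m s =1 id) (m_neq0 : m%:R != 0 :> k).

(** The averaging formula for the projector onto the [z]-eigenspace of [s], valid when [z] is an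
    [m]-th root of unity. *)
Definition eigproj (z : k) (v : V) : V :=
  m%:R^-1 *: \sum_(j < m) z ^- j *: iter j s v.

Lemma iter_lin j a u v : iter j s (a *: u + v) = a *: iter j s u + iter j s v.
Proof. by elim: j => //= j ->; rewrite sL. Qed.

Lemma eigproj_lin z a u v : eigproj z (a *: u + v) = a *: eigproj z u + eigproj z v.
Proof.
rewrite /eigproj scalerA mulrC -scalerA -scalerDr; congr (_ *: _).
rewrite scaler_sumr -big_split /=; apply: eq_bigr => j _.
by rewrite iter_lin scalerDr !scalerA mulrC.
Qed.

Lemma eigproj0 z : eigproj z 0 = 0.
Proof.
by have := eigproj_lin z (-1) 0 0; rewrite scaler0 addr0 => {1}->; rewrite scaleN1r addNr.
Qed.

Lemma eigprojZ z a v : eigproj z (a *: v) = a *: eigproj z v.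
Proof. by have := eigproj_lin z a v 0; rewrite eigproj0 !addr0. Qed.

Let s0 : s 0 = 0.
Proof. by have := sL (-1) 0 0; rewrite scaler0 addr0 => {1}->; rewrite scaleN1r addNr. Qed.

Let sZ a u : s (a *: u) = a *: s u.
Proof. by rewrite -[a *: u]addr0 sL s0 !addr0. Qed.

Let s_sum (I : Type) (r : seq I) (F : I -> V) : s (\sum_(i <- r) F i) = \sum_(i <- r) s (F i).
Proof.
elim: r => [|i r IH]; first by rewrite !big_nil s0.
by rewrite !big_cons -IH -[F i]scale1r sL !scale1r.
Qed.

(** Applying [s] shifts the summation index by one; the term that overflows, at [j = m], returns to
    [j = 0] because [s^m] is the identity and [z^m = 1]. *)
Lemma eigprojE z v : z ^+ m = 1 -> s (eigproj z v) = z *: eigproj z v.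
Proof.
move=> zm; have zn0 : z != 0.
  by apply/eqP => z0; move/eqP: zm; rewrite z0 expr0n eqn0Ngt m_gt0 /= eq_sym oner_eq0.
rewrite /eigproj sZ s_sum scalerA mulrC -scalerA; congr (_ *: _).
rewrite scaler_sumr.
transitivity (\sum_(j < m) z *: (z ^- j.+1 *: iter j.+1 s v)).
  by apply: eq_bigr => j _; rewrite sZ scalerA exprS invfM mulrA mulfV // mul1r.
rewrite -!scaler_sumr; congr (_ *: _).
case: m m_gt0 s_m zm => // p _ sp zp.
rewrite [LHS]big_ord_recr [RHS]big_ord_recl /= zp expr0 invr1 -iterS sp addrC.
by congr (_ + _); apply: eq_bigr => j _; rewrite /bump /= add1n.
Qed.

Lemma eigproj_eig z y v : s v = y *: v -> exists a, eigproj z v = a *: v.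
Proof.
move=> sv; have itv j : iter j s v = y ^+ j *: v.
  elim: j => [|j IH]; first by rewrite expr0 scale1r.
  by rewrite iterS IH sZ sv scalerA exprSr.
exists (m%:R^-1 * \sum_(j < m) z ^- j * y ^+ j).
rewrite /eigproj -scalerA; congr (_ *: _); rewrite scaler_suml.
by apply: eq_bigr => j _; rewrite itv scalerA.
Qed.

Lemma eigproj_id z v : z != 0 -> s v = z *: v -> eigproj z v = v.
Proof.
move=> zn0 sv; have itv j : iter j s v = z ^+ j *: v.
  elim: j => [|j IH]; first by rewrite expr0 scale1r.
  by rewrite iterS IH sZ sv scalerA exprSr.
rewrite /eigproj; under eq_bigr => j _ do
  rewrite itv scalerA mulVf ?expf_neq0 // scale1r.
by rewrite sumr_const card_ord -scaler_nat scalerA mulVf // scale1r.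
Qed.

Lemma eigproj_comm (t : V -> V) z v :
  (forall a x y, t (a *: x + y) = a *: t x + t y) -> (forall v, t (s v) = s (t v)) ->
  t (eigproj z v) = eigproj z (t v).
Proof.
move=> tL ts.
have t0 : t 0 = 0.
  by have := tL (-1) 0 0; rewrite scaler0 addr0 => {1}->; rewrite scaleN1r addNr.
have tZ a u : t (a *: u) = a *: t u by rewrite -[a *: u]addr0 tL t0 !addr0.
have tD u w : t (u + w) = t u + t w by rewrite -[u]scale1r tL !scale1r.
rewrite /eigproj tZ (big_morph t tD t0); congr (_ *: _); apply: eq_bigr => j _.
rewrite tZ; congr (_ *: _); elim: (j : nat) => //= i <-; exact: ts.
Qed.

(** Orthogonality of characters: after exchanging the sums, the coefficient of [s^j v] is a sum of
    powers of [z^-j], which vanishes unless [j = 0]. *)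
Lemma sum_eigproj z v : m.-primitive_root z -> v = \sum_(a < m) eigproj (z ^+ a) v.
Proof.
move=> prim; rewrite /eigproj -scaler_sumr exchange_big /=.
rewrite (bigD1 (Ordinal m_gt0)) //= [X in _ + X]big1 ?addr0.
  under eq_bigr => a _ do rewrite expr0 invr1 scale1r.
  by rewrite sumr_const card_ord -scaler_nat scalerA mulVf // scale1r.
move=> j jn0; rewrite -scaler_suml.
under eq_bigr => a _ do rewrite exprAC -exprVn.
set w := (z ^+ j)^-1.
suff -> : \sum_(a < m) w ^+ a = 0 by rewrite scale0r.
(* A geometric sum whose ratio [w] differs from 1, by primitivity of [z], while [w^m = 1]. *)
apply/eqP; have wn1 : w - 1 != 0.
  rewrite subr_eq0 invr_eq1 -(prim_order_dvd prim) gtnNdvd //.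
  by rewrite lt0n; apply: contraNneq jn0 => j0; apply/eqP/val_inj.
rewrite -(mulrI_eq0 _ (mulfI wn1)) -subrX1.
by rewrite exprVn exprAC (prim_expr_order prim) expr1n invr1 subrr.
Qed.
End EigProj.

(** Frees [brL] and [formL] from the support list that [suppL] happens to choose. *)
Lemma sum_supp_eq (T : eqType) (V : nmodType) (s1 s2 : seq T) (F : T -> V) :
  uniq s1 -> uniq s2 -> (forall l, l \notin s1 -> F l = 0) ->
  (forall l, l \notin s2 -> F l = 0) -> \sum_(l <- s1) F l = \sum_(l <- s2) F l.
Proof.
move=> u1 u2 F1 F2.
have red (s s' : seq T) : (forall l, l \notin s' -> F l = 0) ->
    \sum_(l <- s) F l = \sum_(l <- [seq l <- s | l \in s']) F l.
  move=> Fs'; rewrite big_filter [RHS]big_mkcond; apply: eq_bigr => l _.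
  by case: ifPn => // /Fs'.
rewrite (red s1 s2) // (red s2 s1) //; apply: perm_big.
apply: uniq_perm; rewrite ?filter_uniq // => l.
by rewrite !mem_filter andbC.
Qed.

(** * Multiloop algebras *)

Section OneMultiloop.
Variables (k : closedFieldType) (k_char0 : [pchar k] =i pred0) (zeta : nat -> k).
Hypothesis zeta_prim : forall N : nat, (0 < N)%N -> N.-primitive_root (zeta N).
Variables (n : nat) (M : mlData k n) (HM : is_mlData M).

Local Notation g := (ml_g M).
Local Notation br := (ml_br M).
Local Notation sigma := (ml_sigma M).
Local Notation m := (ml_m M).
Local Notation Zn := 'rV[int]_n.
Local Notation eigsp := (eigsp zeta (M := M)).
Local Notation inL := (inL zeta (M := M)).
Local Notation homL := (homL zeta (M := M)).

Let br_linl : forall a x y z, br (a *: x + y) z = a *: br x z + br y z.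
Proof. by have [[[]]] := HM. Qed.
Let br_linr : forall a x y z, br x (a *: y + z) = a *: br x y + br x z.
Proof. by have [[[]]] := HM. Qed.
Let brxx x : br x x = 0.
Proof. by have [[[]]] := HM. Qed.

Lemma brDl x y z : br (x + y) z = br x z + br y z.
Proof. by have := br_linl 1 x y z; rewrite !scale1r. Qed.
Lemma brDr x y z : br x (y + z) = br x y + br x z.
Proof. by have := br_linr 1 x y z; rewrite !scale1r. Qed.
Lemma br0l z : br 0 z = 0.
Proof. by have /eqP := brDl 0 0 z; rewrite addr0 addrC -subr_eq subrr eq_sym => /eqP. Qed.
Lemma br0r z : br z 0 = 0.
Proof. by have /eqP := brDr z 0 0; rewrite addr0 addrC -subr_eq subrr eq_sym => /eqP. Qed.
Lemma brZl a x z : br (a *: x) z = a *: br x z.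
Proof. by have := br_linl a x 0 z; rewrite br0l !addr0. Qed.
Lemma brZr a x z : br z (a *: x) = a *: br z x.
Proof. by have := br_linr a z x 0; rewrite br0r !addr0. Qed.
Lemma br_anti x y : br x y = - br y x.
Proof.
have := brxx (x + y); rewrite brDl !brDr !brxx add0r addr0 => /eqP.
by rewrite addr_eq0 => /eqP.
Qed.
Lemma br_suml (I : Type) (s : seq I) (F : I -> g) z :
  br (\sum_(i <- s) F i) z = \sum_(i <- s) br (F i) z.
Proof. by apply: (big_morph (br^~ z)) => [x y|]; [exact: brDl | exact: br0l]. Qed.
Lemma br_sumr (I : Type) (s : seq I) (F : I -> g) z :
  br z (\sum_(i <- s) F i) = \sum_(i <- s) br z (F i).
Proof. by apply: (big_morph (br z)) => [x y|]; [exact: brDr | exact: br0r]. Qed.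

Lemma sigma_lin i a x y : sigma i (a *: x + y) = a *: sigma i x + sigma i y.
Proof. by have [_ /(_ i)[]] := HM. Qed.
Lemma sigma_br i x y : sigma i (br x y) = br (sigma i x) (sigma i y).
Proof. by have [_ /(_ i)[]] := HM. Qed.
Lemma sigma_comm i j x : sigma i (sigma j x) = sigma j (sigma i x).
Proof. by have [_ _ /(_ i j x)] := HM. Qed.
Lemma m_gt0 i : (0 < m i)%N.
Proof. by have [_ _ _ []] := HM. Qed.
Lemma sigma_m i : iter (m i) (sigma i) =1 id.
Proof. by have [_ _ _ []] := HM. Qed.
Lemma sigma0 i : sigma i 0 = 0.
Proof.
by have := sigma_lin i (-1) 0 0; rewrite scaler0 addr0 => {1}->; rewrite scaleN1r addNr.
Qed.
Lemma sigmaZ i a x : sigma i (a *: x) = a *: sigma i x.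
Proof. by have := sigma_lin i a x 0; rewrite sigma0 !addr0. Qed.

Lemma natr_neq0 N : (0 < N)%N -> N%:R != 0 :> k.
Proof. by move=> N0; move/pcharf0P: k_char0 => ->; rewrite -lt0n. Qed.

Lemma zeta_neq0 i : zeta (m i) != 0.
Proof.
apply/eqP => z0; have /eqP := prim_expr_order (zeta_prim (m_gt0 i)).
by rewrite z0 expr0n eqn0Ngt m_gt0 eq_sym oner_eq0.
Qed.

(** * The simultaneous eigenspaces of the [sigma_i] in [g] *)

Lemma eigsp_lin l : lin_closed (eigsp l).
Proof.
split=> [i|a u v Pu Pv i]; first by rewrite sigma0 scaler0.
by rewrite sigma_lin Pu Pv scalerDr !scalerA mulrC.
Qed.

Lemma eigsp_br l l' x y : eigsp l x -> eigsp l' y -> eigsp (l + l') (br x y).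
Proof.
by move=> ex ey i; rewrite sigma_br ex ey brZl brZr scalerA mxE expfzDr ?zeta_neq0.
Qed.

Lemma eigsp0P x : fixed_all x <-> eigsp 0 x.
Proof. by split=> H i; have := H i; rewrite mxE expr0z scale1r. Qed.

Lemma zetaX_m i (a : int) : (zeta (m i) ^ a) ^+ m i = 1.
Proof. by rewrite exprnP -exprzAC -exprnP prim_expr_order ?exp1rz //; exact/zeta_prim/m_gt0. Qed.

Let ep i (l : Zn) := eigproj (sigma i) (m i) (zeta (m i) ^ l 0 i).
(* The projection of g onto g^{\bar l}. *)
Definition homproj (l : Zn) (v : g) : g := foldr (fun i w => ep i l w) v (enum 'I_n).

Let ep_lin i l a u v : ep i l (a *: u + v) = a *: ep i l u + ep i l v.
Proof. exact/eigproj_lin/sigma_lin. Qed.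

Lemma homproj_lin l a u v : homproj l (a *: u + v) = a *: homproj l u + homproj l v.
Proof. by rewrite /homproj; elim: (enum _) => //= i s ->; rewrite ep_lin. Qed.

Lemma homproj0 l : homproj l 0 = 0.
Proof.
by have := homproj_lin l (-1) 0 0; rewrite scaler0 addr0 => {1}->; rewrite scaleN1r addNr.
Qed.

(** The projector for [i] creates the eigenvalue of [sigma i]; those applied after it commute with
    [sigma i] and keep it. *)
Lemma homproj_eigsp l v : eigsp l (homproj l v).
Proof.
move=> i; rewrite /homproj.
have : i \in enum 'I_n by rewrite mem_enum.
elim: (enum _) => //= j s IH; rewrite in_cons.
have [<- _|_ /IH e] := eqVneq i j.
  by rewrite eigprojE ?m_gt0 ?zetaX_m //; [exact: sigma_lin | exact: sigma_m].
rewrite /ep (eigproj_comm _ _ _ (sigma_lin i)); last by move=> v'; exact: sigma_comm.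
by rewrite e eigprojZ //; exact: sigma_lin.
Qed.

Lemma homproj_id l v : eigsp l v -> homproj l v = v.
Proof.
move=> ev; rewrite /homproj; elim: (enum _) => //= i s ->.
by rewrite /ep eigproj_id ?expfz_neq0 ?zeta_neq0 ?natr_neq0 ?m_gt0 //; exact: sigma_lin.
Qed.

(** Different [l] and [l'] may define the same eigenspace, as only residues modulo the [m_i] count.
    Each projector multiplies [v] by a scalar: if the total scalar is nonzero, [v] is itself a
    multiple of its projection. *)
Lemma homproj_hom l l' v : eigsp l v -> homproj l' v = 0 \/ eigsp l' v.
Proof.
move=> ev; have [a e] : exists a, homproj l' v = a *: v.
  rewrite /homproj; elim: (enum _) => [|i s [a IH]] /=; first by exists 1; rewrite scale1r.
  have [b eb] := eigproj_eig (m i) (sigma_lin i) (zeta (m i) ^ l' 0 i) (ev i).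
  by exists (a * b); rewrite IH /ep eigprojZ ?eb ?scalerA //; exact: sigma_lin.
have [a0|an0] := eqVneq a 0; [left | right]; first by rewrite e a0 scale0r.
have := homproj_eigsp l' v; rewrite e => /(lin_closedZ (eigsp_lin l') a^-1).
by rewrite scalerA mulVf // scale1r.
Qed.

(** [ad x] raises the degree by [l]; the factor that [sigma i] produces on [x] is absorbed into the
    root of unity of the projector. *)
Lemma homproj_br l l' x v : eigsp l x -> homproj l' (br x v) = br x (homproj (l' - l) v).
Proof.
move=> ex; rewrite /homproj; elim: (enum _) => //= i s ->.
move: (foldr _ _ _) => w; rewrite /ep /eigproj brZr br_sumr; congr (_ *: _).
apply: eq_bigr => j _; rewrite brZr.
have -> : iter j (sigma i) (br x w) =
    (zeta (m i) ^ l 0 i) ^+ j *: br x (iter j (sigma i) w).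
  elim: (j : nat) => [|q IH]; first by rewrite expr0 scale1r.
  by rewrite !iterS IH sigmaZ sigma_br ex brZl scalerA exprSr.
rewrite scalerA; congr (_ *: _).
by rewrite !mxE expfzDr ?zeta_neq0 // -invr_expz exprMn invfM exprVn invrK.
Qed.

(** [g] is the sum of its simultaneous eigenspaces. In the induction, [s] lists the indices whose
    automorphism is not yet known to act on [v] by a scalar. *)
Lemma eigsp_ind (P : g -> Prop) :
  lin_closed P -> (forall l v, eigsp l v -> P v) -> forall v, P v.
Proof.
move=> PL PE.
suff H (s : seq 'I_n) (v : g) (l : Zn) :
    (forall i, i \notin s -> sigma i v = zeta (m i) ^ l 0 i *: v) -> P v.
  by move=> v; apply: (H (enum 'I_n) v 0) => i; rewrite mem_enum.
elim: s v l => [|i s IH] v l Hv; first by apply: (PE l) => i; exact: Hv.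
rewrite (sum_eigproj (sigma i) (m_gt0 i) (natr_neq0 (m_gt0 i)) v (zeta_prim (m_gt0 i))).
apply: lin_closed_sum => // a.
pose l' : Zn := \row_j (if j == i then (a : nat)%:Z else l 0 j).
apply: (IH _ l') => j js; rewrite mxE.
have [->|jni] := eqVneq j i.
  rewrite -exprnP eigprojE ?m_gt0 //; [exact: sigma_lin | exact: sigma_m |].
  by rewrite exprAC (prim_expr_order (zeta_prim (m_gt0 i))) expr1n.
rewrite (eigproj_comm _ _ _ (sigma_lin j)); last by move=> v'; exact: sigma_comm.
by rewrite Hv ?eigprojZ ?in_cons ?negb_or ?jni //; exact: sigma_lin.
Qed.

Lemma simple_ideal (P : g -> Prop) :
  lin_closed P -> (forall x y, P y -> P (br x y)) -> (exists v, P v /\ v != 0) ->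
  forall v, P v.
Proof.
move=> PL Pbr [v [Pv vn0]]; have [U UP] := lin_closed_vspace PL.
have [[_ [_ simp]] _ _ _ _] := HM.
have [|U0|Uf w] := simp U; first by move=> x y /UP Py; apply/UP/Pbr.
  by move/UP: Pv; rewrite U0 memv0 (negPf vn0).
by apply/UP; rewrite Uf memvf.
Qed.

Lemma br_neq0 : exists x y, br x y != 0.
Proof. by have [[_ []]] := HM. Qed.

Lemma eigsp_br_neq0 : exists l l' x y, [/\ eigsp l x, eigsp l' y & br x y != 0].
Proof.
apply: contrapT => no; have [x [y /eqP]] := br_neq0; apply.
move: x; apply: eigsp_ind => [|l x ex].
  by split=> [|a u v u0 v0]; rewrite ?br0l // brDl brZl u0 v0 scaler0 addr0.
move: y; apply: eigsp_ind => [|l' y ey].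
  by split=> [|a u v u0 v0]; rewrite ?br0r // brDr brZr u0 v0 scaler0 addr0.
by apply: contrapT => /eqP xy; apply: no; exists l, l', x, y.
Qed.

(** The centre is an ideal of [g]; were it nonzero, it would be all of [g], which is not abelian. *)
Lemma centerless x : (forall l y, eigsp l y -> br x y = 0) -> x = 0.
Proof.
move=> xy; have {}xy y : br x y = 0.
  move: y; apply: eigsp_ind => // .
  by split=> [|a u v u0 v0]; rewrite ?br0r // brDr brZr u0 v0 scaler0 addr0.
apply: contrapT => /eqP xn0.
have [u [v /eqP]] := br_neq0; apply; move: u v.
apply: (@simple_ideal (fun u => forall v, br u v = 0)); last by exists x.
  by split=> [|a u v u0 v0] w; rewrite ?br0l // brDl brZl u0 v0 scaler0 addr0.
by move=> u v v0 w; rewrite (br_anti u) v0 oppr0 br0l.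
Qed.

(** * The [Z^n]-graded algebra [L] *)

(* mono v l is the element v (x) t^l. *)
Definition mono (v : g) (l : Zn) : LT M := fun l' => if l' == l then v else 0.

Lemma mono_lin a u v l : mono (a *: u + v) l = a *: mono u l + mono v l.
Proof. by apply/funext => l'; rewrite /mono !fctE; case: eqP => // _; rewrite scaler0 addr0. Qed.

Lemma mono0 l : mono 0 l = 0.
Proof. by apply/funext => l'; rewrite /mono; case: eqP. Qed.

Lemma mono_self v l : mono v l l = v.
Proof. by rewrite /mono eqxx. Qed.

Lemma fin_supp_uniq (x : LT M) :
  fin_supp x -> exists s : seq Zn, uniq s /\ forall l, l \notin s -> x l = 0.
Proof. by move=> [s Hs]; exists (undup s); rewrite undup_uniq; split=> // l; rewrite mem_undup; exact: Hs. Qed.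

Lemma suppLP (x : LT M) :
  fin_supp x -> uniq (suppL x) /\ forall l, l \notin suppL x -> x l = 0.
Proof. by move/fin_supp_uniq => H; exact: (xgetPex [::] H). Qed.

Lemma fin_supp_mono v l : fin_supp (mono v l).
Proof. by exists [:: l] => l'; rewrite inE /mono => /negPf ->. Qed.

Lemma inL_lin : lin_closed inL.
Proof.
split; first by split; [exists [::] | move=> l; exact: (eigsp_lin l).1].
move=> a x y [[s xs] ex] [[s' ys] ey]; split.
  exists (s ++ s') => l; rewrite mem_cat negb_or => /andP[ls ls'].
  by rewrite !fctE xs // ys // scaler0 addr0.
by move=> l; apply: (eigsp_lin l).2.
Qed.

Lemma inL_mono l v : eigsp l v -> inL (mono v l).
Proof.
move=> ev; split; first exact: fin_supp_mono.
by move=> l'; rewrite /mono; case: eqP => [->|_] //; exact: (eigsp_lin l').1.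
Qed.

Lemma homL_lin l : lin_closed (homL l).
Proof.
split; first by split; [exact: inL_lin.1 | ].
move=> a x y [Lx x0] [Ly y0]; split; first exact: inL_lin.2.
by move=> l' ll'; rewrite !fctE x0 // y0 // scaler0 addr0.
Qed.

Lemma homL_mono l v : eigsp l v -> homL l (mono v l).
Proof. by move=> ev; split; [exact: inL_mono | move=> l'; rewrite /mono => /negPf ->]. Qed.

Lemma homLE l x : homL l x -> x = mono (x l) l.
Proof.
move=> [_ x0]; apply/funext => l'; rewrite /mono.
by have [->//|/x0] := eqVneq l' l.
Qed.

Lemma LT_sum (x : LT M) (s : seq Zn) :
  uniq s -> (forall l, l \notin s -> x l = 0) -> x = \sum_(l <- s) mono (x l) l.
Proof.
move=> us xs; apply/funext => l; rewrite fct_sumE.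
have [ls|ls] := boolP (l \in s).
  rewrite (bigD1_seq l) //= mono_self big1 ?addr0 // => l' l'l.
  by rewrite /mono eq_sym (negPf l'l).
rewrite xs // big_seq big1 // => l' l's; rewrite /mono.
by case: eqP => // e; rewrite e l's in ls.
Qed.

Lemma inL_ind (J : LT M -> Prop) :
  lin_closed J -> (forall l v, eigsp l v -> J (mono v l)) -> forall x, inL x -> J x.
Proof.
move=> JL Jm x [fx ex]; have [u z] := suppLP fx.
rewrite (LT_sum u z); apply: lin_closed_sum => // l; exact: Jm.
Qed.

Lemma brLE (x y : LT M) (s : seq Zn) nu :
  uniq s -> (forall l, l \notin s -> x l = 0) ->
  brL x y nu = \sum_(l <- s) br (x l) (y (nu - l)).
Proof.
move=> us xs; have [u z] := suppLP (ex_intro _ s xs : fin_supp x).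
by apply: sum_supp_eq => // l /[dup] ? => [/z|/xs] ->; rewrite br0l.
Qed.

Lemma brL_mono v l y : brL (mono v l) y = fun nu => br v (y (nu - l)).
Proof.
apply/funext => nu; rewrite (@brLE _ _ [:: l]) ?big_seq1 ?mono_self //.
by move=> l'; rewrite inE /mono => /negPf ->.
Qed.

Lemma brL_mono2 v l w l' : brL (mono v l) (mono w l') = mono (br v w) (l + l').
Proof.
rewrite brL_mono; apply/funext => nu; rewrite /mono subr_eq addrC.
by case: eqP => // _; rewrite br0r.
Qed.

Lemma brL_linr (x : LT M) a y z : brL x (a *: y + z) = a *: brL x y + brL x z.
Proof.
apply/funext => nu; rewrite !fctE /brL scaler_sumr -big_split /=.
by apply: eq_bigr => l _; exact: br_linr.
Qed.

(** Unlike linearity on the right, this needs finite supports, since [brL] sums over a support list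
    of its first argument. *)
Lemma brL_linl a (x y z : LT M) : fin_supp x -> fin_supp y ->
  brL (a *: x + y) z = a *: brL x z + brL y z.
Proof.
move=> [s xs] [s' ys]; apply/funext => nu; rewrite !fctE.
have u := undup_uniq (s ++ s').
have xs2 l : l \notin undup (s ++ s') -> x l = 0.
  by rewrite mem_undup mem_cat negb_or => /andP[/xs].
have ys2 l : l \notin undup (s ++ s') -> y l = 0.
  by rewrite mem_undup mem_cat negb_or => /andP[_ /ys].
rewrite !(brLE _ _ u) //; last by move=> l ls /=; rewrite xs2 // ys2 // scaler0 addr0.
rewrite scaler_sumr -big_split /=.
by apply: eq_bigr => l _; exact: br_linl.
Qed.

Lemma brL0l (y : LT M) : brL 0 y = 0.
Proof.
transitivity (brL (mono 0 0) y); first by rewrite mono0.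
by rewrite brL_mono; apply/funext => nu; rewrite br0l.
Qed.

Lemma brL0r (x : LT M) : brL x 0 = 0.
Proof. by apply/funext => nu; rewrite /brL big1 // => l _; rewrite br0r. Qed.

Lemma inL_brL x y : inL x -> inL y -> inL (brL x y).
Proof.
(* [inL_ind] wants a predicate closed under combinations of arbitrary functions, while linearity
   holds only on [L]; hence [inL x] is carried inside the predicate. The same device recurs
   below. *)
move=> Lx Ly; move: x Lx; suff : forall x, inL x -> inL x /\ inL (brL x y).
  by move=> H x /H[].
apply: inL_ind.
  split; first by rewrite brL0l; split; exact: inL_lin.1.
  move=> a u v [Lu Lu'] [Lv Lv']; split; first exact: inL_lin.2.
  by rewrite brL_linl; [exact: inL_lin.2 | exact: Lu.1 | exact: Lv.1].
move=> l v ev; split; first exact: inL_mono.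
move: y Ly; apply: inL_ind.
  split; first by rewrite brL0r; exact: inL_lin.1.
  by move=> a u w Lu Lw; rewrite brL_linr; exact: inL_lin.2.
by move=> l' w ew; rewrite brL_mono2; apply/inL_mono/eigsp_br.
Qed.

(* If 0 <> x lies in J, choosing a homogeneous z with [z, x] <> 0 and letting the
   exponent of t attached to z vary gives [z, x] t^mu in J for all admissible mu. *)
Lemma graded_simple (J : LT M -> Prop) :
  lin_closed J ->
  (forall l v y, eigsp l v -> inL y -> J y -> J (brL (mono v l) y)) ->
  (exists l v, [/\ eigsp l v, v != 0 & J (mono v l)]) ->
  forall y, inL y -> J y.
Proof.
move=> JL Jbr [l [x [ex xn0 Jx]]].
(* [P] collects the [v] whose components lie in [J] at every exponent. It is an ideal of [g] by
   [homproj_br], so one nonzero bracket in it makes it everything. *)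
pose P v := forall mu, J (mono (homproj mu v) mu).
have J0 : J 0 by exact: JL.1.
have PA : forall v, P v.
  apply: simple_ideal.
  - split=> [mu|a u v Pu Pv mu]; first by rewrite homproj0 mono0.
    by rewrite homproj_lin mono_lin; apply: JL.2.
  - move=> z w Pw; move: z; apply: eigsp_ind.
      split=> [mu|a u v Pu Pv mu]; first by rewrite br0l homproj0 mono0.
      by rewrite br_linl homproj_lin mono_lin; apply: JL.2.
    move=> nu z ez mu; rewrite (homproj_br _ _ ez).
    rewrite -[X in mono _ X](subrKC nu) -brL_mono2.
    by apply: Jbr => //; exact/inL_mono/homproj_eigsp.
  - apply: contrapT => no; move/eqP: xn0; apply.
    apply: centerless => nu z ez; apply: contrapT => /eqP zxn0.
    apply: no; exists (br z x); split; last by rewrite br_anti oppr_eq0.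
    move=> mu; have ezx := eigsp_br ez ex.
    have [->|emu] := homproj_hom mu ezx; first by rewrite mono0.
    rewrite homproj_id // -[mu](subrK l) -brL_mono2.
    apply: Jbr => //; last exact: inL_mono.
    rewrite br_anti oppr_eq0 in zxn0.
    (* [z] must be attached to the exponent [mu - l], so its degree has to agree with [mu - l]. The
       nonzero vector [[z, x]] has both degrees [nu + l] and [mu], and comparing the two eigenvalues
       gives this. *)
    move=> i; have := emu i; rewrite sigma_br ez ex brZl brZr scalerA => e.
    have /eqP : zeta (m i) ^ (mu - l) 0 i == zeta (m i) ^ nu 0 i; last first.
      by move=> ->.
    rewrite !mxE expfzDr ?zeta_neq0 // -invr_expz.
    rewrite -(inj_eq (mulIf (expfz_neq0 (l 0 i) (zeta_neq0 i)))).
    rewrite mulfVK ?expfz_neq0 ?zeta_neq0 //.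
    rewrite eq_sym; move/eqP: e; rewrite -subr_eq0 -scalerBl scaler_eq0 subr_eq0.
    by rewrite (negPf zxn0) orbF.
apply: inL_ind => // mu v ev.
by have := PA v mu; rewrite homproj_id.
Qed.

(* Multiplication by the monomial of exponent t; it preserves L when t lies in N Z^n. *)
Definition shift (t : Zn) (y : LT M) : LT M := fun l => y (l - t).

(** A common multiple of the [m_i], so that adding an element of [N Z^n] to [l] leaves the
    eigenspace unchanged. *)
Let N := (\prod_i m i)%N.

Lemma eigsp_shift l t v : eigsp l v -> eigsp (l + t *+ N) v.
Proof.
move=> ev i; rewrite ev !mxE expfzDr ?zeta_neq0 //.
suff -> : zeta (m i) ^ (t *+ N) 0 i = 1 by rewrite mulr1.
have /dvdnP[q Nq] : (m i %| N)%N by rewrite /N (bigD1 i) //= dvdn_mulr.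
by rewrite Nq mulmxnE mulrnA -mulr_natr natz -exprz_exp -exprnP zetaX_m.
Qed.

Lemma shift_mono t v l : shift t (mono v l) = mono v (l + t).
Proof. by apply/funext => l'; rewrite /shift /mono subr_eq. Qed.

Lemma shift_lin t a x y : shift t (a *: x + y) = a *: shift t x + shift t y.
Proof. by []. Qed.

Lemma shift_inj t x y : shift t x = shift t y -> x = y.
Proof. by move=> e; apply/funext => l; have := congr1 (@^~ (l + t)) e; rewrite /shift addrK. Qed.

Lemma inL_shift t y : inL y -> inL (shift (t *+ N) y).
Proof.
move: y; apply: inL_ind.
  by split=> [|a u v Lu Lv]; [exact: inL_lin.1 | rewrite shift_lin; exact: inL_lin.2].
by move=> l v ev; rewrite shift_mono; apply/inL_mono/eigsp_shift.
Qed.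

Lemma lin_closedI (V : lmodType k) (P Q : V -> Prop) :
  lin_closed P -> lin_closed Q -> lin_closed (fun v => P v /\ Q v).
Proof.
move=> PL QL; split; first by split; [exact: PL.1 | exact: QL.1].
by move=> a u v [Pu Qu] [Pv Qv]; split; [exact: PL.2 | exact: QL.2].
Qed.

Lemma lin_span_ind (V : lmodType k) (P Q : V -> Prop) v :
  lin_closed Q -> (forall e, P e -> Q e) -> lin_span P v -> Q v.
Proof.
move=> QL PQ [s [sP ->]]; elim: s sP => [|p s IH] sP; first by rewrite big_nil; exact: QL.1.
rewrite big_cons; apply: QL.2; first by apply/PQ/sP; left.
by apply: IH => q qs; apply: sP; right.
Qed.

Lemma In_sum_ind (I : Type) (V : lmodType k) (Q : V -> Prop) (s : seq I) (F : I -> V) :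
  lin_closed Q -> (forall p, List.In p s -> Q (F p)) -> Q (\sum_(p <- s) F p).
Proof.
move=> QL; elim: s => [|p s IH] sP; first by rewrite big_nil; exact: QL.1.
rewrite big_cons; apply: lin_closedD => //; first by apply: sP; left.
by apply: IH => q qs; apply: sP; right.
Qed.

(** * Operators on [L]: centroid, degree derivations, [SCDer] *)

(** Endomorphisms of [L] are functions on all of [LT M]; the value 0 outside [L] makes equality of
    functions the same as equality on [L]. *)
Definition L_op (d : EndL M) : Prop :=
  [/\ forall x, ~ inL x -> d x = 0,
      forall x, inL x -> inL (d x) &
      forall a x y, inL x -> inL y -> d (a *: x + y) = a *: d x + d y].

Lemma L_op_lin : lin_closed L_op.
Proof.
split; first by split=> // [x _|a x y _ _]; [exact: inL_lin.1 | rewrite scaler0 addr0].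
move=> a d e [d0 dL dl] [e0 eL el].
have adE x : (a *: d + e) x = a *: d x + e x by [].
split.
- by move=> x nx; rewrite adE d0 // e0 // scaler0 addr0.
- by move=> x Lx; apply: inL_lin.2; [exact: dL | exact: eL].
- move=> b x y Lx Ly; rewrite !adE dl // el // !scalerDr !scalerA [b * a]mulrC.
  by rewrite -!addrA; congr (_ + _); rewrite addrCA.
Qed.

Lemma L_op0 d : L_op d -> d 0 = 0.
Proof.
move=> [_ _ dl]; have := dl (-1) 0 0 inL_lin.1 inL_lin.1.
by rewrite scaler0 addr0 => {1}->; rewrite scaleN1r addNr.
Qed.

Lemma L_opZ d a x : L_op d -> inL x -> d (a *: x) = a *: d x.
Proof.
move=> od Lx; have [_ _ dl] := od; have := dl a x 0 Lx inL_lin.1.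
by rewrite (L_op0 od) !addr0.
Qed.

Lemma L_op_ker d e : L_op d -> L_op e -> lin_closed (fun x => inL x /\ d x = e x).
Proof.
move=> od oe; split; first by split; [exact: inL_lin.1 | rewrite !L_op0].
move=> a x y [Lx dx] [Ly dy]; split; first exact: inL_lin.2.
by have [_ _ dl] := od; have [_ _ el] := oe; rewrite dl // el // dx dy.
Qed.

Lemma L_op_ext d e : L_op d -> L_op e ->
  (forall l v, eigsp l v -> d (mono v l) = e (mono v l)) -> d = e.
Proof.
move=> od oe de; apply/funext => x.
have [Lx|nLx] := pselect (inL x); last first.
  by have [d0 _ _] := od; have [e0 _ _] := oe; rewrite d0 // e0.
suff [] : inL x /\ d x = e x by [].
move: x Lx; apply: inL_ind; first exact: L_op_ker.
by move=> l v ev; split; [exact: inL_mono | exact: de].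
Qed.

Definition L_op_deg (mu : Zn) (d : EndL M) : Prop :=
  L_op d /\ forall nu x, homL nu x -> homL (mu + nu) (d x).

Lemma L_op_deg_lin mu : lin_closed (L_op_deg mu).
Proof.
split; first by split; [exact: L_op_lin.1 | move=> nu x _; exact: (homL_lin _).1].
move=> a d e [od dh] [oe eh]; split; first exact: L_op_lin.2.
by move=> nu x hx; apply: (homL_lin _).2; [exact: dh | exact: eh].
Qed.

Lemma centroid_op c : centroid zeta c -> L_op c.
Proof. by case. Qed.

Lemma thvD (th : 'rV[k]_n) (l l' : Zn) : thv th (l + l') = thv th l + thv th l'.
Proof.
by rewrite /thv -big_split; apply: eq_bigr => i _; rewrite mxE rmorphD mulrDr.
Qed.

Lemma dtheta_mono (th : 'rV[k]_n) l v : eigsp l v ->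
  dtheta zeta th (mono v l) = thv th l *: mono v l.
Proof.
move=> ev; rewrite /dtheta; case: asboolP => [_|/(_ (inL_mono ev))] //.
by apply/funext => l'; rewrite /mono !fctE; case: eqP => [->|_] //; rewrite !scaler0.
Qed.

Lemma dthetaE (th : 'rV[k]_n) x l : inL x -> dtheta zeta th x l = thv th l *: x l.
Proof. by move=> Lx; rewrite /dtheta; case: asboolP. Qed.

Lemma dtheta_op (th : 'rV[k]_n) : L_op_deg 0 (dtheta zeta th).
Proof.
have dL x : inL x -> inL (dtheta zeta th x).
  move=> Lx; split; last by move=> l; rewrite dthetaE //; apply/(lin_closedZ (eigsp_lin l))/Lx.2.
  by have [[s xs] _] := Lx; exists s => l ls; rewrite dthetaE // xs // scaler0.
split; first split=> //.
- by move=> x nx; rewrite /dtheta; case: asboolP.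
- move=> a x y Lx Ly; apply/funext => l; rewrite dthetaE; last exact: inL_lin.2.
  by rewrite !fctE !dthetaE // scalerDr !scalerA mulrC.
- move=> nu x [Lx x0]; rewrite add0r; split; first exact: dL.
  by move=> l ln; rewrite dthetaE // x0 // scaler0.
Qed.

Lemma L_op_comp d e : L_op d -> L_op e -> L_op (d \o e).
Proof.
move=> od oe; have [d0 dL dl] := od; have [e0 eL el] := oe; split=> /=.
- by move=> x nx; rewrite e0 // L_op0.
- by move=> x Lx; exact/dL/eL.
- by move=> a x y Lx Ly; rewrite el // dl //; exact: eL.
Qed.

Lemma L_op_deg_comp mu mu' d e :
  L_op_deg mu d -> L_op_deg mu' e -> L_op_deg (mu + mu') (d \o e).
Proof.
move=> [od dh] [oe eh]; split; first exact: L_op_comp.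
by move=> nu x hx; rewrite -addrA; exact/dh/eh.
Qed.

Lemma L_op_comm mu mu' d e :
  L_op_deg mu d -> L_op_deg mu' e -> L_op_deg (mu + mu') (commE d e).
Proof.
move=> dd de; have dde := L_op_deg_comp dd de; have := L_op_deg_comp de dd.
rewrite addrC => ded; have := lin_closedD (L_op_deg_lin _) dde (lin_closedZ (L_op_deg_lin _) (-1) ded).
by rewrite scaleN1r.
Qed.

Lemma SCDer_mu_deg mu d : SCDer_mu zeta mu d -> L_op_deg mu d.
Proof.
apply: lin_span_ind; first exact: L_op_deg_lin.
move=> e [c [th [[cc ch] _ ->]]].
rewrite -[mu]addr0; apply: L_op_deg_comp (dtheta_op th).
by split; first exact: centroid_op.
Qed.

Lemma SCDer_ind (Q : EndL M -> Prop) d : lin_closed Q ->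
  (forall c th, centroid zeta c -> Q (c \o dtheta zeta th)) -> SCDer zeta d -> Q d.
Proof.
move=> QL Qc [s [sP ->]]; apply: In_sum_ind => // p /sP[_].
by apply: lin_span_ind => // e [c [th [[cc _] _ ->]]]; exact: Qc.
Qed.

Lemma SCDer_op d : SCDer zeta d -> L_op d.
Proof.
apply: SCDer_ind; first exact: L_op_lin.
move=> c th cc; apply: L_op_comp; [exact: centroid_op | exact: (dtheta_op th).1].
Qed.

(** This is [L = [L, L]]: the brackets span an ideal that contains a nonzero monomial. *)
Lemma perfect_ind (J : LT M -> Prop) : lin_closed J ->
  (forall l v y, eigsp l v -> inL y -> J (brL (mono v l) y)) -> forall y, inL y -> J y.
Proof.
move=> JL Jbr; apply: graded_simple => // [l v y ev Ly _|]; first exact: Jbr.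
have [l [l' [x [y [ex ey xy]]]]] := eigsp_br_neq0.
exists (l + l'), (br x y); split=> //; first exact: eigsp_br.
by rewrite -brL_mono2; apply: Jbr => //; exact: inL_mono.
Qed.

Lemma brL_mono_shift l v t x :
  brL (mono v (l + t)) x = shift t (brL (mono v l) x).
Proof. by rewrite !brL_mono; apply/funext => nu; rewrite /shift opprD addrA addrAC. Qed.

(** In a bracket the shift can be moved to the first factor, on which [c] does not act; brackets
    span [L]. *)
Lemma centroid_shift c t y : centroid zeta c -> inL y ->
  c (shift (t *+ N) y) = shift (t *+ N) (c y).
Proof.
move=> cc Ly; have oc := centroid_op cc; have [_ cL cl cbr] := cc.
suff [] : inL y /\ c (shift (t *+ N) y) = shift (t *+ N) (c y) by [].
move: y Ly; apply: perfect_ind.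
  split; first by split; [exact: inL_lin.1 | rewrite (_ : shift _ 0 = 0) // (L_op0 oc)].
  move=> a x y [Lx xs] [Ly ys]; split; first exact: inL_lin.2.
  by rewrite shift_lin !cl //; [rewrite xs ys | exact: inL_shift | exact: inL_shift].
move=> l v y ev Ly; have Lv := inL_mono ev; split; first exact: inL_brL.
by rewrite -brL_mono_shift !cbr // ?brL_mono_shift //; exact/inL_mono/eigsp_shift.
Qed.

Lemma homogeneous_exists : exists l v, eigsp l v /\ v != 0.
Proof.
have [l [_ [x [y [ex _ xy]]]]] := eigsp_br_neq0; exists l, x; split=> //.
by apply: contra_neq xy => ->; rewrite br0l.
Qed.

(** Schur's argument: [c] has an eigenvector in some nonzero, finite-dimensional degree, and the
    subspace where [c] equals that eigenvalue is an ideal, hence all of [L]. *)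
Lemma centroid0_scalar c : centroid_mu zeta 0 c ->
  exists a, forall x, inL x -> c x = a *: x.
Proof.
move=> [cc ch]; have oc := centroid_op cc; have [_ cL cl cbr] := cc.
have cE l v : eigsp l v -> homL l (c (mono v l)).
  by move=> ev; have := ch l _ (homL_mono ev); rewrite add0r.
have [l [v0 [ev0 v0n0]]] := homogeneous_exists.
have [a [v [ev vn0 fv]]] : exists a v, [/\ eigsp l v, v != 0 & c (mono v l) l = a *: v].
  apply: (eigenvector_exists (P := eigsp l) (f := fun v => c (mono v l) l)).
  - exact: eigsp_lin.
  - by move=> v /cE[[_ H] _]; exact: H.
  - by move=> a u v eu ev; rewrite mono_lin cl //; exact: inL_mono.
  - by exists v0.
exists a => x Lx; suff [] : inL x /\ c x = a *: x by [].
move: x Lx; apply: graded_simple.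
- split; first by split; [exact: inL_lin.1 | rewrite (L_op0 oc) scaler0].
  move=> b x y [Lx cx] [Ly cy]; split; first exact: inL_lin.2.
  by rewrite cl // cx cy scalerDr !scalerA mulrC.
- move=> l' w y ew Ly [_ cy]; have Lw := inL_mono ew; split; first exact: inL_brL.
  rewrite cbr // cy; have := brL_linr (mono w l') a y 0.
  by rewrite brL0r !addr0.
- exists l, v; split=> //; split; first exact: inL_mono.
  rewrite (homLE (cE _ _ ev)) fv; have := mono_lin a v 0 l.
  by rewrite mono0 !addr0.
Qed.

Lemma N_gt0 : (0 < N)%N.
Proof. by rewrite /N prodn_gt0 // => i; exact: m_gt0. Qed.

(* ad x commutes with the shifts by N Z^n, whereas d (t^(N mu) y) - t^(N mu) (d y)
   depends additively on mu, and d is recovered from this difference. *)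
Lemma SCDer_outer x d : inL x -> SCDer zeta d ->
  (forall l v, eigsp l v -> brL (mono v l) x = d (mono v l)) -> x = 0 /\ d = 0.
Proof.
move=> Lx Sd xd.
(* [B l] is [d] with the scalar [theta(l)] frozen: for [c \o dtheta th] it is [thv th l *: c].
   Unlike that product form, the properties in [Q] survive linear combinations. *)
pose Q (d : EndL M) := exists B : Zn -> EndL M,
   [/\ forall l l' y, B (l + l') y = B l y + B l' y,
       forall l t y, inL y -> B l (shift (t *+ N) y) = shift (t *+ N) (B l y) &
       forall l v, eigsp l v -> d (mono v l) = B l (mono v l)].
have [B [BD BS dB]] : Q d.
  apply: (SCDer_ind (Q := Q)) Sd.
    split; first by exists (fun _ _ => 0); split=> // *; rewrite addr0.
    move=> a d' e [B [BD BS dB]] [C [CD CS eC]].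
    exists (fun l y => a *: B l y + C l y); split.
    - by move=> l l' y; rewrite BD CD scalerDr addrACA.
    - by move=> l t y Ly; rewrite BS // CS.
    - by move=> l v ev; rewrite !fctE dB // eC.
  move=> c th cc; exists (fun l y => thv th l *: c y); split.
  - by move=> l l' y; rewrite thvD scalerDl.
  - by move=> l t y Ly; rewrite centroid_shift.
  - move=> l v ev /=; rewrite dtheta_mono // L_opZ //; [exact: centroid_op | exact: inL_mono].
have B0 t y : B (t *+ N) y = B t y *+ N.
  elim: (N) => [|q IH]; last by rewrite !mulrSr BD IH.
  rewrite !mulr0n; have /eqP := BD 0 0 y; rewrite addr0.
  by rewrite addrC -subr_eq subrr eq_sym => /eqP.
have d0 : d = 0.
  apply: L_op_ext; [exact: SCDer_op | exact: L_op_lin.1 |] => l v ev.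
  (* Shifting by [l *+ N], with the same [l] as the monomial, makes the discrepancy exactly [N]
     times [B l (mono v l)], that is [N] times [d (mono v l)]; in characteristic 0 this value is
     therefore zero. *)
  have := xd _ _ (eigsp_shift l ev).
  rewrite brL_mono_shift xd // dB // dB; last exact: eigsp_shift.
  rewrite -shift_mono BD BS ?B0 ?BS; [|exact: inL_mono..].
  have -> : forall y, shift (l *+ N) y *+ N = shift (l *+ N) (y *+ N).
    by move=> y; apply/funext => l'; rewrite /shift !natmulfctE.
  move=> /(@shift_inj (l *+ N) _ (_ + _)) /eqP.
  rewrite -subr_eq0 opprD addrA subrr sub0r oppr_eq0 -scaler_nat scaler_eq0.
  by rewrite (negPf (natr_neq0 N_gt0)) => /eqP.
split=> //; apply/funext => l; suff xl : x l = 0 by [].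
apply: centerless => l' v ev; rewrite br_anti.
have := xd _ _ ev; rewrite d0 brL_mono => /(congr1 (@^~ (l + l'))) /=.
by rewrite addrK => ->; rewrite oppr0.
Qed.

Lemma lin_span_lin (V : lmodType k) (P : V -> Prop) : lin_closed (lin_span P).
Proof.
split; first by exists [::]; rewrite big_nil.
move=> a _ _ [s [sP ->]] [s' [sP' ->]].
exists ([seq (a * p.1, p.2) | p <- s] ++ s'); split.
  move=> p /List.in_app_iff[/List.in_map_iff[q [<- /sP]]|/sP'] //.
rewrite big_cat big_map scaler_sumr; congr (_ + _).
by apply: eq_bigr => i _; rewrite scalerA.
Qed.

Lemma killing_linl a x y z :
  killing br (a *: x + y) z = a * killing br x z + killing br y z.
Proof.
pose lf u v := linfun (fun w => br u (br v w)).
have lfE u v w : lf u v w = br u (br v w).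
  (* [linfun] is known to evaluate to its argument only for a bundled linear map, hence the explicit
     packing. *)
  have lin : linear (fun w => br u (br v w)) by move=> b w1 w2; rewrite !br_linr.
  pose f := GRing.isLinear.Build _ _ _ _ (fun w => br u (br v w)) lin.
  pose F : {linear g -> g} := HB.pack (fun w => br u (br v w)) f.
  exact: (lfunE F w).
have -> : killing br (a *: x + y) z = \tr (passmx.mxof (vbasis fullv) (vbasis fullv) (lf (a *: x + y) z)) by [].
have -> : lf (a *: x + y) z = a *: lf x z + lf y z.
  by apply/lfunP => w; rewrite add_lfunE scale_lfunE !lfE br_linl.
by rewrite passmx.mxof_linear mxtraceD mxtraceZ.
Qed.

Lemma killing0l z : killing br 0 z = 0.
Proof. by have := killing_linl (-1) 0 0 z; rewrite scaler0 addr0 => {1}->; rewrite mulN1r addNr. Qed.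

Lemma killing0r x : killing br x 0 = 0.
Proof.
rewrite -[RHS](killing0l 0); congr (\tr (passmx.mxof _ _ (linfun _))).
by apply/funext => w; rewrite br0l br0r br0l.
Qed.

Lemma formLE (x y : LT M) (s : seq Zn) :
  uniq s -> (forall l, l \notin s -> x l = 0) ->
  formL x y = \sum_(l <- s) killing br (x l) (y (- l)).
Proof.
move=> us xs; have [u z] := suppLP (ex_intro _ s xs : fin_supp x).
by apply: sum_supp_eq => // l /[dup] ? => [/z|/xs] ->; rewrite killing0l.
Qed.

Lemma formL_linl a (x y z : LT M) : fin_supp x -> fin_supp y ->
  formL (a *: x + y) z = a * formL x z + formL y z.
Proof.
move=> [s xs] [s' ys].
have u := undup_uniq (s ++ s').
have xs2 l : l \notin undup (s ++ s') -> x l = 0.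
  by rewrite mem_undup mem_cat negb_or => /andP[/xs].
have ys2 l : l \notin undup (s ++ s') -> y l = 0.
  by rewrite mem_undup mem_cat negb_or => /andP[_ /ys].
have xys2 l : l \notin undup (s ++ s') -> (a *: x + y) l = 0.
  by move=> ls /=; rewrite !fctE xs2 // ys2 // scaler0 addr0.
rewrite (formLE _ u xs2) (formLE _ u ys2) (formLE _ u xys2).
rewrite mulr_sumr -big_split /=.
by apply: eq_bigr => l _; exact: killing_linl.
Qed.

Lemma formL0r (x : LT M) : formL x 0 = 0.
Proof. by rewrite /formL big1 // => l _; exact: killing0r. Qed.

Lemma zopE (x : LT M) : (0 : EndL M) x = 0.
Proof. by []. Qed.

Definition zeroE : ET M := ((0, fun=> 0), 0).

(** * Ideals of E(L, D, tau) *)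

Section Extension.
Variables (D : EndL M -> Prop) (tau : EndL M -> EndL M -> EndL M -> k).
Hypothesis HP : inPL zeta D tau.

Local Notation Dmu := (Dmu zeta D).
Local Notation inC := (inC zeta D).
Local Notation isE := (Defs.inE zeta D).
Local Notation brE := (brE D tau).

Lemma D_lin : lin_closed D.
Proof. by have [[[D0 DD _ _ _] _] _ _ _ _] := HP; split. Qed.
Lemma D_SCDer d : D d -> SCDer zeta d.
Proof. by have [[[_ _ H _ _] _] _ _ _ _] := HP; exact: H. Qed.
Lemma D_comm d e : D d -> D e -> D (commE d e).
Proof. by have [[[_ _ _ H _] _] _ _ _ _] := HP; exact: H. Qed.
Lemma D_op d : D d -> L_op d.
Proof. by move/D_SCDer/SCDer_op. Qed.
Lemma D_inL d x : D d -> inL x -> inL (d x).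
Proof. by move=> Dd Lx; have [_ H _] := D_op Dd; exact: H. Qed.

Lemma D_sum d : D d -> exists s : seq (Zn * EndL M),
  (forall p, List.In p s -> Dmu p.1 p.2) /\ d = \sum_(p <- s) p.2.
Proof.
have [[[_ _ _ _ H] _] _ _ _ _] := HP; move=> /H[s [sP ->]].
by exists s; split=> // p /sP[].
Qed.

Lemma Dmu_deg mu d : Dmu mu d -> L_op_deg mu d.
Proof. by move=> [_]; exact: SCDer_mu_deg. Qed.

Lemma Dmu_lin mu : lin_closed (Dmu mu).
Proof. exact: lin_closedI D_lin (lin_span_lin _). Qed.

(** Closure of [D] only yields some decomposition of [[d, e]] into homogeneous pieces. Those of
    degree other than [mu + nu] do not contribute at the degrees where [[d, e]] lives, so [[d, e]]
    equals the sum of the remaining pieces. *)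
Lemma Dmu_comm mu nu d e : Dmu mu d -> Dmu nu e -> Dmu (mu + nu) (commE d e).
Proof.
move=> Dd De; have dF := L_op_comm (Dmu_deg Dd) (Dmu_deg De).
have [s [sP sE]] := D_sum (D_comm Dd.1 De.1).
pose F' := \sum_(p <- s) (if p.1 == mu + nu then p.2 else 0).
have DF' : Dmu (mu + nu) F'.
  apply: In_sum_ind; first exact: Dmu_lin.
  by move=> p /sP; case: eqP => [->|] // _ _; exact: (Dmu_lin _).1.
suff -> : commE d e = F' by [].
have dF' := Dmu_deg DF'.
apply: L_op_ext; [exact: dF.1 | exact: dF'.1 |] => l v ev; apply/funext => l'.
have hv := homL_mono ev.
have [l'E|l'n] := eqVneq l' (mu + nu + l); last first.
  by rewrite (dF.2 _ _ hv).2 // (dF'.2 _ _ hv).2.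
rewrite sE /F' !fct_sumE.
elim: s sP {sE F' DF' dF'} => [|p s IH] sP; first by rewrite !big_nil.
rewrite !big_cons IH; last by move=> q qs; apply: sP; right.
congr (_ + _); case: eqP => // pn.
have hp : List.In p (p :: s) by left.
rewrite ((Dmu_deg (sP _ hp)).2 _ _ hv).2 //.
by rewrite l'E (inj_eq (addIr l)) eq_sym; exact/eqP.
Qed.

Lemma inC0 : inC (fun=> 0).
Proof. by split=> // [*|]; [rewrite mulr0 addr0 | exists [::]]. Qed.

Lemma inC_lin a c c' : inC c -> inC c' -> inC (fun d => a * c d + c' d).
Proof.
move=> [c0 cl [s cs]] [c0' cl' [s' cs']]; split.
- by move=> d nd; rewrite c0 // c0' // mulr0 addr0.
- move=> b d1 d2 D1 D2; rewrite cl // cl' // !mulrDr !mulrA [b * a]mulrC.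
  by rewrite -!addrA; congr (_ + _); rewrite addrCA.
- exists (s ++ s') => mu d; rewrite mem_cat negb_or => /andP[ms ms'] Dd.
  by rewrite (cs mu) // (cs' mu) // mulr0 addr0.
Qed.

Lemma inCD c c' : inC c -> inC c' -> inC (c + c').
Proof.
move=> Cc Cc'; have := inC_lin 1 Cc Cc'.
by congr inC; apply/funext => d; rewrite mul1r.
Qed.

Lemma inCB c c' : inC c -> inC c' -> inC (c - c').
Proof.
move=> Cc Cc'; have := inC_lin (-1) Cc' Cc.
by congr inC; apply/funext => d; rewrite mulN1r addrC.
Qed.

Lemma inC_sigmaD x y : inL x -> inL y -> inC (sigmaD D x y).
Proof.
move=> Lx Ly; have [ux zx] := suppLP Lx.1; have [uy zy] := suppLP Ly.1.
split.
- by move=> d nd; rewrite /sigmaD; case: asboolP.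
- move=> a d1 d2 D1 D2; rewrite /sigmaD !asboolT //; last exact: D_lin.2.
  by apply: formL_linl; [exact: (D_inL D1 Lx).1 | exact: (D_inL D2 Lx).1].
(* For the form to be nonzero, [d] of degree [mu] must carry some [l] in the support of [x] to the
   negative of some [l'] in that of [y], so [mu = -(l + l')]. *)
- exists [seq - (l + l') | l <- suppL x, l' <- suppL y] => mu d mun Dd.
  rewrite /sigmaD asboolT; last exact: Dd.1.
  rewrite /formL big1 // => l _.
  suff [->|->] : d x l = 0 \/ y (- l) = 0; [by rewrite killing0l | by rewrite killing0r |].
  have [ly|ly] := boolP (- l \in suppL y); last by right; exact: zy.
  left; have dd := Dmu_deg Dd; have [_ _ dl] := dd.1.
  suff H z : inL z -> z (l - mu) = 0 -> d z l = 0.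
    apply: H => //; apply: zx; apply: contra mun => lx.
    apply/allpairsP; exists (l - mu, - l); split=> //=.
    by rewrite addrAC subrr add0r opprK.
  move=> [fz ez] zl; have [uz zz] := suppLP fz.
  pose J w := inL w /\ d w l = 0.
  have JL : lin_closed J.
    split; first by split; [exact: inL_lin.1 | rewrite (L_op0 dd.1)].
    move=> a w w' [Lw w0] [Lw' w0']; split; first exact: inL_lin.2.
    by rewrite dl // !fctE w0 w0' scaler0 addr0.
  suff [] : J z by [].
  rewrite (LT_sum uz zz); apply: (lin_closed_sum JL) => l1; split; first exact: inL_mono.
  have [e|ne] := eqVneq l (mu + l1).
    by rewrite e addrC addKr in zl; rewrite zl mono0 (L_op0 dd.1).
  by rewrite (dd.2 _ _ (homL_mono (ez l1))).2.
Qed.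

Lemma commE_lin d a e f : L_op d -> L_op e -> L_op f ->
  commE d (a *: e + f) = a *: commE d e + commE d f.
Proof.
move=> od oe o_f; apply: L_op_ext.
- have oef := L_op_lin.2 a e f oe o_f.
  have := L_op_lin.2 (-1) _ _ (L_op_comp oef od) (L_op_comp od oef).
  by rewrite scaleN1r addrC.
- have oc u : L_op u -> L_op (commE d u).
    move=> ou; have := L_op_lin.2 (-1) _ _ (L_op_comp ou od) (L_op_comp od ou).
    by rewrite scaleN1r addrC.
  by apply: L_op_lin.2; exact: oc.
- move=> l v ev; have Lv := inL_mono ev; have [_ _ dl] := od.
  have eE w : (a *: e + f) w = a *: e w + f w by [].
  have cE : (a *: commE d e + commE d f) (mono v l) =
      a *: commE d e (mono v l) + commE d f (mono v l) by [].
  rewrite cE /commE !eE dl; [|by have [_ + _] := oe; apply|by have [_ + _] := o_f; apply].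
  by rewrite scalerBr opprD addrACA.
Qed.

Lemma commE0 d : L_op d -> commE d 0 = 0.
Proof. by move=> od; apply/funext => x; rewrite -[LHS]/(d 0 - 0) (L_op0 od) subrr. Qed.

Lemma comm0E d : L_op d -> commE 0 d = 0.
Proof. by move=> od; apply/funext => x; rewrite -[LHS]/(0 - d 0) (L_op0 od) subrr. Qed.

Lemma inC_actC d c : D d -> inC c -> inC (actC D d c).
Proof.
move=> Dd [c0 cl [s cs]]; split.
- by move=> e ne; rewrite /actC; case: asboolP.
- move=> a e f De Df; rewrite /actC !asboolT //; last exact: D_lin.2.
  rewrite commE_lin; [|exact: D_op..].
  by rewrite cl; [rewrite opprD mulrN | exact: D_comm..].
have [t [tP dE]] := D_sum Dd.
(* If [d] has components of degrees [q] and [c] sees only degrees [nu] in [s], then [c([d, e])] can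
   be nonzero for [e] of degree [mu] only when [mu + q = nu]. *)
exists [seq nu - q | nu <- s, q <- [seq p.1 | p <- t]] => mu e mun De.
rewrite /actC asboolT; last exact: De.1.
have c00 : c 0 = 0.
  by have := cl (-1) 0 0 D_lin.1 D_lin.1; rewrite scaler0 addr0 => {1}->; rewrite mulN1r addNr.
have cN f : D f -> c (- f) = - c f.
  by move=> Df; have := cl (-1) f 0 Df D_lin.1; rewrite addr0 scaleN1r c00 addr0 mulN1r.
have -> : commE d e = - commE e d by apply/funext => x; rewrite -[RHS]/(- (e (d x) - d (e x))) opprB.
rewrite cN; last exact: D_comm De.1 Dd.
suff [_ ->] : D d /\ c (commE e d) = 0 by rewrite !oppr0.
rewrite dE; apply: (@In_sum_ind _ _ (fun f => D f /\ c (commE e f) = 0)).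
  split.
    split; first exact: D_lin.1.
    by rewrite commE0 //; exact: D_op De.1.
  move=> a f f' [Df cf] [Df' cf']; split; first exact: D_lin.2.
  rewrite commE_lin; [|exact: D_op De.1|exact: D_op|exact: D_op].
  rewrite cl; [|exact: D_comm De.1 _|exact: D_comm De.1 _].
  by rewrite cf cf' mulr0 addr0.
move=> p pt; have Dp := tP _ pt; split; first exact: Dp.1.
apply: (cs (mu + p.1)); last exact: Dmu_comm.
apply: contra mun => ms; apply/allpairsP; exists (mu + p.1, p.1); split=> //=.
  elim: t pt {tP dE} => //= q t IH [->|/IH H]; first exact: mem_head.
  by rewrite inE H orbT.
by rewrite addrK.
Qed.

Lemma tau0l d : D d -> tau 0 d = fun=> 0.
Proof.
have [_ [_ tl _ _] _ _ _] := HP; move=> Dd.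
have := tl (-1) 0 0 d D_lin.1 D_lin.1 Dd; rewrite scaler0 addr0 => t0.
by apply/funext => e; rewrite t0 mulN1r addNr.
Qed.

Lemma brE_L e1 e2 :
  (brE e1 e2).1.1 = brL e1.1.1 e2.1.1 + e1.2 e2.1.1 - e2.2 e1.1.1.
Proof. by case: e1 => [[x1 c1] d1]; case: e2 => [[x2 c2] d2]. Qed.

Lemma brE_C e1 e2 : (brE e1 e2).1.2 = sigmaD D e1.1.1 e2.1.1 + actC D e1.2 e2.1.2
  - actC D e2.2 e1.1.2 + tau e1.2 e2.2.
Proof. by case: e1 => [[x1 c1] d1]; case: e2 => [[x2 c2] d2]. Qed.

Lemma brE_D e1 e2 : (brE e1 e2).2 = commE e1.2 e2.2.
Proof. by case: e1 => [[x1 c1] d1]; case: e2 => [[x2 c2] d2]. Qed.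

Lemma inE_br e1 e2 : isE e1 -> isE e2 -> isE (brE e1 e2).
Proof.
move=> [L1 C1 D1] [L2 C2 D2]; split.
- rewrite brE_L -[X in _ - X]scale1r -scaleNr addrC; apply: inL_lin.2.
    exact: D_inL.
  by apply: (lin_closedD inL_lin); [exact: inL_brL | exact: D_inL].
- rewrite brE_C; apply: inCD; last by have [_ [tC _ _ _] _ _ _] := HP; exact: tC.
  apply: inCB; last exact: inC_actC.
  by apply: inCD; [exact: inC_sigmaD | exact: inC_actC].
- by rewrite brE_D; exact: D_comm.
Qed.

Lemma inE_zero : isE zeroE.
Proof. by split; [exact: inL_lin.1 | exact: inC0 | exact: D_lin.1]. Qed.

Lemma inE_lin a e1 e2 : isE e1 -> isE e2 -> isE (addE (scaleE a e1) e2).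
Proof.
move=> [L1 C1 D1] [L2 C2 D2].
by split; [exact: inL_lin.2 | exact: inC_lin | exact: D_lin.2].
Qed.

Definition inCE (e : ET M) : Prop := [/\ isE e, e.1.1 = 0 & e.2 = 0].
Definition inLC (e : ET M) : Prop := isE e /\ e.2 = 0.

Definition E_ideal (J : ET M -> Prop) : Prop :=
  [/\ forall e, J e -> isE e, J zeroE,
      forall a e1 e2, J e1 -> J e2 -> J (addE (scaleE a e1) e2) &
      forall e j, isE e -> J j -> J (brE e j)].

Definition E_abelian (J : ET M -> Prop) : Prop :=
  forall e1 e2, J e1 -> J e2 -> brE e1 e2 = zeroE.

Lemma actC0 c : inC c -> actC D 0 c = fun=> 0.
Proof.
move=> [c0 cl _]; apply/funext => d; rewrite /actC; case: asboolP => // Dd.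
rewrite comm0E; last exact: D_op.
have := cl (-1) 0 0 D_lin.1 D_lin.1.
by rewrite scaler0 addr0 => {1}->; rewrite mulN1r addNr oppr0.
Qed.

Lemma sigmaD0r x : sigmaD D x 0 = fun=> 0.
Proof. by apply/funext => d; rewrite /sigmaD; case: asboolP => // _; rewrite formL0r. Qed.

Lemma CE_ideal : E_ideal inCE.
Proof.
split.
- by move=> e [].
- by split; first exact: inE_zero.
- move=> a e1 e2 [E1 x1 d1] [E2 x2 d2]; split; first exact: inE_lin.
    by rewrite /= x1 x2 scaler0 addr0.
  by rewrite /= d1 d2 scaler0 addr0.
- move=> e j Ee [Ej x0 d0]; have [_ _ De] := Ee; split; first exact: inE_br.
    by rewrite brE_L x0 d0 brL0r (L_op0 (D_op De)) zopE addr0 subrr.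
  by rewrite brE_D d0 commE0 //; exact: D_op.
Qed.

Lemma CE_abelian : E_abelian inCE.
Proof.
move=> e1 e2 I1 I2; have [[L1 C1 D1] x1 d1] := I1; have [[L2 C2 D2] x2 d2] := I2.
have [_ _ _ /(_ e1 e2 (And3 L1 C1 D1) I2)[_ xb db]] := CE_ideal.
have cb : (brE e1 e2).1.2 = fun=> 0.
  rewrite brE_C x1 x2 d1 d2 sigmaD0r !actC0 // tau0l; last exact: D_lin.1.
  by apply/funext => d; rewrite -[LHS]/(0 + 0 - 0 + 0) subr0 !addr0.
by case: (brE e1 e2) xb db cb => [[x c] d] /= -> -> ->.
Qed.

Lemma LC_ideal : E_ideal inLC.
Proof.
split.
- by move=> e [].
- by split; first exact: inE_zero.
- move=> a e1 e2 [E1 d1] [E2 d2]; split; first exact: inE_lin.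
  by rewrite /= d1 d2 scaler0 addr0.
- move=> e j Ee [Ej d0]; have [_ _ De] := Ee; split; first exact: inE_br.
  by rewrite brE_D d0 commE0 //; exact: D_op.
Qed.

Lemma inE_L x : inL x -> isE ((x, fun=> 0), 0).
Proof. by split; [| exact: inC0 | exact: D_lin.1]. Qed.

Lemma ev_separates l l' : l != l' ->
  exists th, Dmu 0 (dtheta zeta th) /\ thv th l != thv th l'.
Proof.
move=> ll'; apply: contrapT => no; move/eqP: ll'; apply; apply/eqP; rewrite -subr_eq0.
have [[_ ev] _ _ _ _] := HP; apply/eqP/ev => th Dth; apply: contrapT => /eqP thn.
apply: no; exists th; split=> //; apply: contra thn => /eqP e.
by apply/eqP/(addIr (thv th l')); rewrite -thvD subrK add0r.
Qed.

(* The elements of J outside C yield a nonzero D^0-stable, hence graded, ideal of L. *)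
Lemma ideal_dichotomy (J : ET M -> Prop) : E_ideal J ->
  (forall e, J e -> inCE e) \/ (forall y, inL y -> exists c, J ((y, c), 0)).
Proof.
move=> [JE J0 JD Jbr].
have [[e0 [Je0 ne0]]|no] := pselect (exists e, J e /\ ~ inCE e); last first.
  by left=> e Je; apply: contrapT => ne; apply: no; exists e.
(* The [L]-components of the elements of [J] in [L + C]; the action of [E] preserves them. *)
right; pose JL y := inL y /\ exists c, J ((y, c), 0).
have JLL : lin_closed JL.
  split; first by split; [exact: inL_lin.1 | exists (fun=> 0)].
  move=> a x y [Lx [c Jx]] [Ly [c' Jy]]; split; first exact: inL_lin.2.
  have := JD a _ _ Jx Jy; rewrite /addE /scaleE /= scaler0 addr0 => H.
  by exists (fun d => a * c d + c' d).
have JLbr e y : isE e -> JL y -> JL (brL e.1.1 y + e.2 y).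
  move=> Ee [Ly [c Jy]]; have := Jbr _ _ Ee Jy; have [Le Ce De] := Ee => Je.
  have [Lb _ _] := JE _ Je; move: Lb Je.
  have := brE_L e ((y, c), 0); have := brE_D e ((y, c), 0) => /=.
  rewrite commE0; last exact: D_op.
  case: (brE e _) => [[x' c'] d'] /= -> -> Lb Je.
  by move: Lb Je; rewrite !zopE subr0 => Lb Je; split=> //; exists c'.
suff H y : inL y -> JL y by move=> y /H[].
move: y; apply: graded_simple => //.
  move=> l v y ev Ly Jy; have := JLbr _ _ (inE_L (inL_mono ev)) Jy.
  by rewrite /= !zopE addr0.
have [y [Jy yn0]] : exists y, JL y /\ y != 0.
  (* Bracketing [v t^l] with [e0 = x + c + d] gives an element of [J] without [D]-component and with
     [L]-component [[v t^l, x] - d(v t^l)]. If [JL] is zero, [d] is inner, so [SCDer_outer] puts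
     [e0] in [C]. *)
  apply: contrapT => nz; apply: ne0.
  have JL0 y : JL y -> y = 0 by move=> Jy; apply: contrapT => /eqP yn; apply: nz; exists y.
  have [L0 C0 D0] := JE _ Je0.
  have [|x0 d0] := SCDer_outer L0 (D_SCDer D0); last by split=> //; exact: JE.
  move=> l v ev; apply/eqP; rewrite -subr_eq0; apply/eqP/JL0.
  have := Jbr _ _ (inE_L (inL_mono ev)) Je0.
  have := brE_L ((mono v l, fun=> 0), 0) e0; have := brE_D ((mono v l, fun=> 0), 0) e0.
  case: (brE _ e0) => [[x' c'] d']; rewrite [LHS]/= [X in X = _ -> _]/=.
  rewrite comm0E => [->|]; last exact: D_op.
  by rewrite /= zopE addr0 => -> Jb; have [Lb _ _] := JE _ Jb; split=> //; exists c'.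
have [Ly _] := Jy; have [s ys] := Ly.1.
(* Induction on a list containing the support. If [y] has two components [l] and [l'], apply
   [d_theta - theta(l)] with [theta] separating them: this kills the first and only rescales the
   second. *)
elim: s y {Ly} ys Jy yn0 => [|l s IH] y ys Jy yn0.
  by move/eqP: yn0; case; apply/funext => l; exact: ys.
have [Ly _] := Jy; have [yl|yl] := eqVneq (y l) 0.
  apply: (IH y) => // l' l's; have [->//|l'l] := eqVneq l' l.
  by apply: ys; rewrite inE negb_or l'l.
have [[l' [l'l yl']]|no] := pselect (exists l', l' != l /\ y l' != 0); last first.
  exists l, (y l); have <- : y = mono (y l) l.
    apply/funext => l'; rewrite /mono; case: eqP => [->//|/eqP l'l].
    by apply: contrapT => /eqP yl'; apply: no; exists l'.
  by split=> //; exact: Ly.2.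
have [th [Dth thn]] := ev_separates l'l.
have wE l'' : (- thv th l *: y + dtheta zeta th y) l'' = (thv th l'' - thv th l) *: y l''.
  by rewrite !fctE dthetaE // addrC scaleNr scalerBl.
apply: (IH (- thv th l *: y + dtheta zeta th y)).
- move=> l'' l''s; rewrite wE; have [->|l''l] := eqVneq l'' l; first by rewrite subrr scale0r.
  by rewrite ys ?scaler0 // inE negb_or l''l.
- apply: JLL.2 => //; have := JLbr ((0, fun=> 0), dtheta zeta th) y.
  by rewrite /= brL0l add0r; apply=> //; split; [exact: inL_lin.1 | exact: inC0 | exact: Dth.1].
- apply/eqP => /(congr1 (@^~ l')); rewrite wE => /eqP.
  by rewrite scaler_eq0 subr_eq0 (negPf thn) (negPf yl').
Qed.

(** Otherwise [J] contains lifts [x + c] and [y + c'] of elements with [[x, y]] nonzero, and the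
    bracket of the lifts has [L]-component [[x, y]]. *)
Lemma abelian_ideal_sub (J : ET M -> Prop) : E_ideal J -> E_abelian J ->
  forall e, J e -> inCE e.
Proof.
move=> JI Jab; have [//|JL] := ideal_dichotomy JI.
have [l [l' [x [y [ex ey /eqP[]]]]]] := eigsp_br_neq0.
have [c Jx] := JL _ (inL_mono ex); have [c' Jy] := JL _ (inL_mono ey).
have := congr1 (fun e : ET M => e.1.1 (l + l')) (Jab _ _ Jx Jy).
by rewrite brE_L /= !zopE subr0 addr0 brL_mono2 mono_self.
Qed.

(** * Joint eigenspaces of H *)

Local Notation h := (ml_h M).
Local Notation inH := (inH zeta D).

Lemma h_eigsp v : v \in h -> eigsp 0 v.
Proof. by have [_ _ _ _ [hF _ _ _]] := HM; move/hF/eigsp0P. Qed.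

Lemma inH_inE e : inH e -> isE e.
Proof.
move=> [[eh e0] [eC _] [eD _]]; split=> //.
have -> : e.1.1 = mono (e.1.1 0) 0.
  by apply/funext => l; rewrite /mono; case: eqP => [->//|/eqP /e0].
exact/inL_mono/h_eigsp.
Qed.

(** The [L]-component of [[e, x]], that is, the action of [e] on [(L + C)/C]. *)
Definition actE (e : ET M) (x : LT M) : LT M := brL e.1.1 x + e.2 x.

Lemma actE_inH e x l : inH e -> actE e x l = br (e.1.1 0) (x l) + e.2 x l.
Proof.
move=> [[eh e0] _ _].
have E : e.1.1 = mono (e.1.1 0) 0.
  by apply/funext => l'; rewrite /mono; case: eqP => [->//|/eqP /e0].
by rewrite /actE {1}E brL_mono -[LHS]/(br _ (x (l - 0)) + e.2 x l) subr0.
Qed.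

Lemma thv_lin a (th th' : 'rV[k]_n) l : thv (a *: th + th') l = a * thv th l + thv th' l.
Proof.
rewrite /thv mulr_sumr -big_split; apply: eq_bigr => i _.
by rewrite !mxE mulrDl mulrA.
Qed.

Lemma thv0l (l : Zn) : thv (0 : 'rV[k]_n) l = 0.
Proof. by rewrite /thv big1 // => i _; rewrite mxE mul0r. Qed.

Lemma dtheta_lin a (th th' : 'rV[k]_n) :
  dtheta zeta (a *: th + th') = a *: dtheta zeta th + dtheta zeta th' :> EndL M.
Proof.
apply: L_op_ext.
- exact: (dtheta_op _).1.
- by apply: L_op_lin.2; exact: (dtheta_op _).1.
- move=> l v ev; rewrite -[RHS]/(a *: dtheta zeta th (mono v l) + dtheta zeta th' (mono v l)).
  by rewrite !dtheta_mono // thv_lin scalerDl scalerA.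
Qed.

(** Here [C(L)^0 = k] enters: a generator [c \o dtheta th] of degree 0 has [c] scalar, and the
    scalar can be moved into [th]. *)
Lemma Dmu0_dtheta d : Dmu 0 d -> exists th, d = dtheta zeta th.
Proof.
move=> [_]; apply: (lin_span_ind (Q := fun d => exists th, d = dtheta zeta th)).
  split=> [|a d1 d2 [th1 ->] [th2 ->]]; last by exists (a *: th1 + th2); rewrite dtheta_lin.
  exists 0; have := dtheta_lin (-1) 0 0.
  by rewrite scaler0 addr0 => {1}->; rewrite scaleN1r addNr.
move=> _ [c [th [c0 _ ->]]]; have [a ca] := centroid0_scalar c0; exists (a *: th).
apply: L_op_ext; [|exact: (dtheta_op _).1|].
  by apply: L_op_comp; [exact: centroid_op c0.1 | exact: (dtheta_op _).1].
move=> l v ev; rewrite /= ca; last by have [[_ + _] _] := dtheta_op th; apply; exact: inL_mono.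
have := thv_lin a th 0 l; rewrite addr0 thv0l addr0 => aE.
by rewrite !dtheta_mono // scalerA aE.
Qed.

(** There may be no element of degree [l] to test on. Comparing instead at the degrees [l0] and
    [l0 + N l] of one fixed nonzero vector [v] gives equality of [N] times the values, and [N] is
    cancelled. *)
Lemma dtheta_inj (th th' : 'rV[k]_n) l :
  dtheta zeta th = dtheta zeta th' :> EndL M -> thv th l = thv th' l.
Proof.
have [l0 [v [ev vn0]]] := homogeneous_exists => e.
have E l' : eigsp l' v -> thv th l' = thv th' l'.
  move=> ev'; have := congr1 (fun d : EndL M => d (mono v l') l') e.
  rewrite !dtheta_mono // -[LHS]/(_ *: mono v l' l') -[RHS]/(_ *: mono v l' l') mono_self.
  by move/eqP; rewrite -subr_eq0 -scalerBl scaler_eq0 (negPf vn0) orbF subr_eq0 => /eqP.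
have thN (t : 'rV[k]_n) : thv t (l *+ N) = thv t l *+ N.
  elim: (N) => [|q IH]; last by rewrite !mulrSr thvD IH.
  by rewrite !mulr0n /thv big1 // => i _; rewrite mxE mulr0.
have := E _ (eigsp_shift l ev); rewrite !thvD (E _ ev) !thN => /addrI.
rewrite -(mulr_natr (thv th l)) -(mulr_natr (thv th' l)).
exact/mulIf/natr_neq0/N_gt0.
Qed.

Definition theta_of (d : EndL M) : 'rV[k]_n := xget 0 [set th | d = dtheta zeta th].

Lemma theta_ofK d : Dmu 0 d -> d = dtheta zeta (theta_of d).
Proof. by move/Dmu0_dtheta => H; exact: (xgetPex 0 H). Qed.

(* The pair (alpha, lambda) as a linear form on H; theta_of picks a theta with
   d = d_theta, which matters only through its values on Z^n. *)
Definition Hweight (p : weight M * Zn) (e : ET M) : k :=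
  \sum_i coord (vbasis h) i (e.1.1 0) * p.1 0 i + thv (theta_of e.2) p.2.

Lemma HweightD p q e : Hweight (p + q) e = Hweight p e + Hweight q e.
Proof.
rewrite /Hweight thvD addrACA; congr (_ + _).
by rewrite -big_split; apply: eq_bigr => i _; rewrite mxE mulrDr.
Qed.

Lemma rootspE (a : weight M) v x : rootsp a x -> v \in h ->
  br v x = (\sum_i coord (vbasis h) i v * a 0 i) *: x.
Proof.
move=> ax vh; rewrite {1}(coord_vbasis vh) br_suml scaler_suml.
apply: eq_bigr => i _; have := ax i; rewrite (tnth_nth 0) => axi.
by rewrite brZl axi scalerA.
Qed.

Lemma Lroot_actE p x e : inH e -> Lroot zeta p x -> actE e x = Hweight p e *: x.
Proof.
move=> He [[Lx x0] rx]; apply/funext => l; rewrite actE_inH //.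
have [[eh e0] _ /theta_ofK dE] := He.
rewrite dE dthetaE // -[RHS]/(_ *: x l).
have [->|lp] := eqVneq l p.2; last by rewrite x0 // !scaler0 br0r addr0.
by rewrite (rootspE rx eh) -scalerDl.
Qed.

Lemma inH_h v : v \in h -> inH ((mono v 0, fun=> 0), 0).
Proof.
move=> vh; split=> /=.
- by rewrite mono_self; split=> // l; rewrite /mono => /negPf ->.
- by split; [exact: inC0 | ].
- exact: (Dmu_lin 0).1.
Qed.

Lemma inH_dtheta th : Dmu 0 (dtheta zeta th) -> inH ((0, fun=> 0), dtheta zeta th).
Proof. by move=> Dth; split=> //=; [split=> //; exact: mem0v | split; [exact: inC0 |]]. Qed.

Lemma Hweight_h p v : Hweight p ((mono v 0, fun=> 0), 0) =
  \sum_i coord (vbasis h) i v * p.1 0 i.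
Proof.
rewrite /Hweight /= mono_self [X in _ + X](_ : _ = 0) ?addr0 //.
have D0 : Dmu 0 0 by exact: (Dmu_lin 0).1.
rewrite (@dtheta_inj _ 0 p.2) -?(theta_ofK D0); first exact: thv0l.
have := dtheta_lin (-1) 0 0.
by rewrite scaler0 addr0 => {1}->; rewrite scaleN1r addNr.
Qed.

Lemma Hweight_dtheta p th : Dmu 0 (dtheta zeta th) ->
  Hweight p ((0, fun=> 0), dtheta zeta th) = thv th p.2.
Proof.
move=> Dth; rewrite /Hweight /= big1 ?add0r => [|i _]; last by rewrite linear0 mul0r.
by apply: dtheta_inj; rewrite -theta_ofK.
Qed.

Lemma Hweight_inj p q : (forall e, inH e -> Hweight p e = Hweight q e) -> p = q.
Proof.
move=> pq; rewrite [p]surjective_pairing [q]surjective_pairing; congr pair.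
  apply/rowP => i; have bi : tnth (vbasis h) i \in h by apply/vbasis_mem/mem_tnth.
  have := pq _ (inH_h bi); rewrite !Hweight_h.
  have cE j : coord (vbasis h) j (tnth (vbasis h) i) = (i == j)%:R.
    by rewrite (tnth_nth 0) coord_free // (basis_free (vbasisP h)).
  have sE (a : weight M) :
      \sum_j coord (vbasis h) j (tnth (vbasis h) i) * a 0 j = a 0 i.
    rewrite (bigD1 i) //= cE eqxx mul1r big1 ?addr0 // => j ji.
    by rewrite cE eq_sym (negPf ji) mul0r.
  by rewrite !sE.
apply: contrapT => /eqP /ev_separates[th [Dth]]; case/eqP.
by rewrite -!Hweight_dtheta //; apply/pq/inH_dtheta.
Qed.

(** Two nonzero components of [y] would have different eigenvalues under some [d_theta] in [D^0], so
    [y] is homogeneous; its eigenvalues under the basis of [h] are then the coordinates of the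
    root. *)
Lemma Hweight_exists y : inL y -> y != 0 ->
  (forall e, inH e -> exists a, actE e y = a *: y) -> exists p, Lroot zeta p y.
Proof.
move=> Ly yn0 eig; have [l yl] : exists l, y l != 0.
  apply: contrapT => no; move/eqP: yn0; case; apply/funext => l.
  by apply: contrapT => /eqP yl; apply: no; exists l.
have yl' l' : l' != l -> y l' = 0.
  move=> l'l; have [th [Dth thn]] := ev_separates l'l.
  have [a ya] := eig _ (inH_dtheta Dth).
  have E l'' : thv th l'' *: y l'' = a *: y l''.
    rewrite -dthetaE // -[RHS]/((a *: y) l'') -ya actE_inH; last exact: inH_dtheta.
    by rewrite br0l add0r.
  apply: contrapT => /eqP yl'; move/eqP: thn; case.
  have cancel l'' : y l'' != 0 -> thv th l'' = a.
    move=> yn; have /eqP := E l''.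
    by rewrite -subr_eq0 -scalerBl scaler_eq0 (negPf yn) orbF subr_eq0 => /eqP.
  by rewrite !cancel.
have /choice[a aP] : forall i : 'I_(\dim h), exists a, br (tnth (vbasis h) i) (y l) = a *: y l.
  move=> i; have bi : tnth (vbasis h) i \in h by apply/vbasis_mem/mem_tnth.
  have [a ya] := eig _ (inH_h bi); exists a.
  rewrite -[RHS]/((a *: y) l) -ya actE_inH; last exact: inH_h.
  by rewrite /= mono_self zopE addr0.
exists (\row_i a i, l); split; first by split.
by move=> i; rewrite mxE.
Qed.

(** Expresses root spaces through the action of [H] alone, which is what [chi] transports. The zero
    vector is treated apart, as it does not determine a weight. *)
Lemma LrootP p x : Lroot zeta p x <->
  inL x /\ forall e, inH e -> actE e x = Hweight p e *: x.
Proof.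
split=> [px|[Lx ex]]; first by split; [case: px => [[]] | move=> e He; exact: Lroot_actE].
have [->|xn0] := eqVneq x 0.
  split; first exact: (homL_lin _).1.
  by move=> i; rewrite br0r scaler0.
have [q xq] : exists q, Lroot zeta q x.
  by apply: Hweight_exists => // e He; exists (Hweight p e); exact: ex.
suff -> : p = q by [].
apply: Hweight_inj => e He; have := ex e He; rewrite (Lroot_actE He xq) => /eqP.
by rewrite -subr_eq0 -scalerBl scaler_eq0 (negPf xn0) orbF subr_eq0 => /eqP.
Qed.
End Extension.
End OneMultiloop.

(** * The induced support isomorphism *)

Section GenSubgroup.
Variables (T : zmodType) (A : T -> Prop).

Lemma gen_subgroup_incl x : A x -> gen_subgroup A x.
Proof.
by move=> Ax; exists [:: (x, 1)]; rewrite big_seq1 mulr1z; split=> // p [<-|].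
Qed.

Lemma gen_subgroup0 : gen_subgroup A 0.
Proof. by exists [::]; rewrite big_nil. Qed.

Lemma gen_subgroupB x y : gen_subgroup A x -> gen_subgroup A y -> gen_subgroup A (x - y).
Proof.
move=> [s [sA ->]] [t [tA ->]]; exists (s ++ [seq (p.1, - p.2) | p <- t]); split.
  by move=> p /List.in_app_iff[/sA|/List.in_map_iff[q [<- /tA]]].
rewrite big_cat big_map -sumrN; congr (_ + _).
by apply: eq_bigr => p _; rewrite mulrNz.
Qed.

Lemma gen_subgroup_ind (Q : T -> Prop) x :
  Q 0 -> (forall y z, Q y -> Q z -> Q (y - z)) -> (forall y, A y -> Q y) ->
  gen_subgroup A x -> Q x.
Proof.
move=> Q0 QB QA [s [sA ->]].
have QN y : Q y -> Q (- y) by move=> Qy; rewrite -sub0r; exact: QB.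
have QD y z : Q y -> Q z -> Q (y + z) by move=> Qy Qz; rewrite -[z]opprK; exact/QB/QN.
have Qn y q : Q y -> Q (y *+ q) by move=> Qy; elim: q => // q IH; rewrite mulrS; exact: QD.
have Qz y z : Q y -> Q (y *~ z) by move=> Qy; case: z => q; [exact: Qn | exact/QN/Qn].
elim: s sA => [|p s IH] sA; first by rewrite big_nil.
rewrite big_cons; apply: QD; first by apply/Qz/QA/sA; left.
by apply: IH => q qs; apply: sA; right.
Qed.
End GenSubgroup.

Lemma LT_scale_inj (k : closedFieldType) (n : nat) (M : mlData k n) a b (x : LT M) :
  x != 0 -> a *: x = b *: x -> a = b.
Proof.
move=> xn0 /eqP; rewrite -subr_eq0 -scalerBl scaler_eq0 (negPf xn0) orbF subr_eq0.
by move=> /eqP.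
Qed.

Lemma addE_opp (k : closedFieldType) (n : nat) (M : mlData k n) (e : ET M) :
  addE (scaleE (-1) e) e = zeroE M.
Proof.
case: e => [[x c] d]; rewrite /addE /scaleE /zeroE /= !scaleN1r !addNr.
by congr (_, _, _); apply/funext => f; rewrite mulN1r addNr.
Qed.

Lemma ET_split (k : closedFieldType) (n : nat) (M : mlData k n) (e : ET M) : e.2 = 0 ->
  e = addE (scaleE 1 ((e.1.1, fun=> 0), 0)) ((0, e.1.2), 0).
Proof.
case: e => [[x c] d] /= ->; rewrite /addE /scaleE /= !scale1r !addr0.
by congr (_, _, _); apply/funext => f; rewrite mulr0 add0r.
Qed.

Section Isomorphism.
Variables (k : closedFieldType) (k_char0 : [pchar k] =i pred0) (zeta : nat -> k).
Hypothesis zeta_prim : forall N : nat, (0 < N)%N -> N.-primitive_root (zeta N).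
Variables (n : nat) (M M' : mlData k n) (HM : is_mlData M) (HM' : is_mlData M').
Variables (D : EndL M -> Prop) (tau : EndL M -> EndL M -> EndL M -> k)
  (D' : EndL M' -> Prop) (tau' : EndL M' -> EndL M' -> EndL M' -> k).
Hypotheses (HP : inPL zeta D tau) (HP' : inPL zeta D' tau').
Variable chi : ET M -> ET M'.
Hypotheses
  (chiE : forall e, Defs.inE zeta D e -> Defs.inE zeta D' (chi e))
  (chi_lin : forall a e1 e2, Defs.inE zeta D e1 -> Defs.inE zeta D e2 ->
     chi (addE (scaleE a e1) e2) = addE (scaleE a (chi e1)) (chi e2))
  (chi_br : forall e1 e2, Defs.inE zeta D e1 -> Defs.inE zeta D e2 ->
     chi (brE D tau e1 e2) = brE D' tau' (chi e1) (chi e2))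
  (chi_inj : forall e1 e2, Defs.inE zeta D e1 -> Defs.inE zeta D e2 -> chi e1 = chi e2 -> e1 = e2)
  (chi_surj : forall e', Defs.inE zeta D' e' -> exists e, Defs.inE zeta D e /\ chi e = e')
  (chiH : forall e, inH zeta D e -> inH zeta D' (chi e))
  (chiH_surj : forall e', inH zeta D' e' -> exists e, inH zeta D e /\ chi e = e').

Local Notation isE := (Defs.inE zeta D).
Local Notation inL := (inL zeta (M := M)).
Local Notation inL' := (Defs.inL zeta (M := M')).

Let chi0 : chi (zeroE M) = zeroE M'.
Proof.
have E0 := inE_zero HM HP.
by rewrite -{1}(addE_opp (zeroE M)) chi_lin // addE_opp.
Qed.

(** [chi] comes without an inverse map, so ideals are moved along it both by preimages and by
    images. *)
Lemma chi_preim_ideal J' : E_ideal zeta D' tau' J' ->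
  E_ideal zeta D tau (fun e => isE e /\ J' (chi e)).
Proof.
move=> [JE J0 JD Jbr]; split.
- by move=> e [].
- by split; [exact: (inE_zero HM HP) | rewrite chi0].
- move=> a e1 e2 [E1 J1] [E2 J2]; split; first exact: (inE_lin HM HP).
  by rewrite chi_lin //; exact: JD.
- move=> e j Ee [Ej Jj]; split; first exact: (inE_br zeta_prim HM HP).
  by rewrite chi_br //; apply: Jbr => //; exact: chiE.
Qed.

Lemma chi_im_ideal J : E_ideal zeta D tau J ->
  E_ideal zeta D' tau' (fun e' => exists e, J e /\ chi e = e').
Proof.
move=> [JE J0 JD Jbr]; split.
- by move=> _ [e [/JE Ee <-]]; exact: chiE.
- by exists (zeroE M).
- move=> a _ _ [e1 [J1 <-]] [e2 [J2 <-]]; exists (addE (scaleE a e1) e2).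
  by split; [exact: JD | rewrite chi_lin //; exact: JE].
- move=> e' _ /chi_surj[e [Ee <-]] [j [Jj <-]]; exists (brE D tau e j).
  by split; [exact: Jbr | rewrite chi_br //; exact: JE].
Qed.

Lemma chi_CE e : inCE zeta D e -> inCE zeta D' (chi e).
Proof.
have CI := CE_ideal zeta_prim HM HP; have CA := CE_abelian zeta_prim HM HP.
move=> Ce; apply: (abelian_ideal_sub k_char0 zeta_prim HM' HP' (chi_im_ideal CI)).
  move=> _ _ [e1 [C1 <-]] [e2 [C2 <-]].
  by rewrite -chi_br ?CA ?chi0 //; [case: C1 | case: C2].
by exists e.
Qed.

Lemma chi_CE_inv e : isE e -> inCE zeta D' (chi e) -> inCE zeta D e.
Proof.
have CI := CE_ideal zeta_prim HM' HP'; have CA := CE_abelian zeta_prim HM' HP'.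
move=> Ee Ce; apply: (abelian_ideal_sub k_char0 zeta_prim HM HP (chi_preim_ideal CI)) => //.
move=> e1 e2 [E1 C1] [E2 C2]; apply: chi_inj; [exact: (inE_br zeta_prim HM HP) | |].
  exact: (inE_zero HM HP).
by rewrite chi_br // CA // chi0.
Qed.

(** The preimage of [L' + C'] is not inside [C], because [chi] is onto, sends [C] into [C'], and
    [L'] is nonzero. By the dichotomy it therefore meets every coset of [C] in [L + C]. *)
Lemma chi_LC e : inLC zeta D e -> inLC zeta D' (chi e).
Proof.
move=> [Ee e0]; split; first exact: chiE.
have [JC|JL] := ideal_dichotomy k_char0 zeta_prim HM HP
    (chi_preim_ideal (LC_ideal zeta_prim HM' HP')).
  have [l [v [ev vn0]]] := homogeneous_exists k_char0 zeta_prim HM'.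
  have Ev := inE_L HP' (inL_mono HM' ev); have [e1 [E1 e1E]] := chi_surj Ev.
  have /JC/chi_CE[_ + _] : isE e1 /\ inLC zeta D' (chi e1) by rewrite e1E.
  by rewrite e1E /= => vl; move: vn0; rewrite -(mono_self v l) vl eqxx.
have [Le Ce De] := Ee; have [c [Ec [_ c0]]] := JL _ Le; have [_ Cc _] := Ec.
(* The element of [C] by which [e] differs from the representative [e.1.1 + c] supplied by the
   dichotomy. *)
pose c1 f := -1 * c f + e.1.2 f.
have C1 : inCE zeta D ((0, c1), 0).
  by split=> //; split; [exact: (inL_lin zeta HM).1 | exact: inC_lin | exact: (D_lin HP).1].
have -> : e = addE (scaleE 1 ((e.1.1, c), 0)) ((0, c1), 0).
  rewrite [LHS]ET_split // /addE /scaleE /= !scale1r.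
  by congr (_, _, _); apply/funext => f; rewrite /c1 mulr0 add0r mul1r mulN1r addrA subrr add0r.
have [C1E _ _] := C1; have [_ _ c10] := chi_CE C1.
by rewrite chi_lin // /= c0 c10 scaler0 addr0.
Qed.

(** The image of [L + C] contains an element with the same [L']-component as [chi e]. Its preimage
    differs from [e] by something mapped into [C'], hence by an element of [C], so [e] has no
    [D]-component. *)
Lemma chi_LC_inv e : isE e -> inLC zeta D' (chi e) -> inLC zeta D e.
Proof.
move=> Ee [Ee' e0]; split=> //.
have [JC|JL] := ideal_dichotomy k_char0 zeta_prim HM' HP'
    (chi_im_ideal (LC_ideal zeta_prim HM HP)).
  have [l [v [ev vn0]]] := homogeneous_exists k_char0 zeta_prim HM.
  have Ev := inE_L HP (inL_mono HM ev).
  have [_ + _] := chi_CE_inv Ev (JC _ (ex_intro _ _ (conj (conj Ev erefl) erefl))).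
  by move=> /= vl; move: vn0; rewrite -(mono_self v l) vl eqxx.
have [Le _ _] := Ee'; have [c [e1 [[E1 e10] e1E]]] := JL _ Le.
have Ed := inE_lin HM HP (-1) E1 Ee.
have [|_ _ /=] := chi_CE_inv Ed.
  split; first exact: chiE.
    by rewrite chi_lin // e1E /= scaleN1r addNr.
  by rewrite chi_lin // e1E /= e0 scaler0 addr0.
by rewrite e10 scaler0 add0r.
Qed.

(** The induced map from [(L + C)/C] to [(L' + C')/C'], read on the representative with zero
    [C]-component; [core_mapE] shows that the choice is immaterial. *)
Definition core_map (x : LT M) : LT M' := (chi ((x, fun=> 0), 0)).1.1.
Local Notation phi := core_map.

Lemma core_mapE e : inLC zeta D e -> (chi e).1.1 = phi e.1.1.
Proof.
move=> [Ee e0]; have [Le Ce De] := Ee; rewrite [in LHS](ET_split e0).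
have C1 : inCE zeta D ((0, e.1.2), 0).
  by split=> //; split=> //; [exact: (inL_lin zeta HM).1 | exact: (D_lin HP).1].
have [E1 _ _] := C1; have [_ c10 _] := chi_CE C1.
by rewrite chi_lin //= ?c10 ?addr0 ?scale1r //; exact: (inE_L HP).
Qed.

Let LCx x : inL x -> inLC zeta D ((x, fun=> 0), 0).
Proof. by move=> /(inE_L HP). Qed.

Lemma core_map_inL x : inL x -> inL' (phi x).
Proof. by move=> /(inE_L HP)/chiE[]. Qed.

Lemma core_map_lin a x y : inL x -> inL y -> phi (a *: x + y) = a *: phi x + phi y.
Proof.
move=> /(inE_L HP) Ex /(inE_L HP) Ey; have := chi_lin a Ex Ey.
have H : inLC zeta D (addE (scaleE a ((x, fun=> 0), 0)) ((y, fun=> 0), 0)).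
  by split; [exact: (inE_lin HM HP) | rewrite /= scaler0 addr0].
by move/(congr1 (fun e : ET M' => e.1.1)); rewrite core_mapE.
Qed.

Lemma core_map_act e x : inH zeta D e -> inL x -> phi (actE e x) = actE (chi e) (phi x).
Proof.
move=> He Lx; have Ee := inH_inE HM He; have Ex := inE_L HP Lx.
have [_ _ _ /(_ _ _ Ee (LCx Lx)) HL] := LC_ideal zeta_prim HM HP.
have := core_mapE HL; rewrite chi_br // !brE_L /= zopE subr0 => <-.
by have [_ c0] := chi_LC (LCx Lx); rewrite c0 zopE subr0.
Qed.

Lemma core_map_br x y : inL x -> inL y -> phi (brL x y) = brL (phi x) (phi y).
Proof.
move=> Lx Ly; have Ex := inE_L HP Lx; have Ey := inE_L HP Ly.
have [_ _ _ /(_ _ _ Ex (LCx Ly)) HL] := LC_ideal zeta_prim HM HP.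
have := core_mapE HL; rewrite chi_br // !brE_L /= !zopE subr0 addr0 => <-.
have [_ c0] := chi_LC (LCx Lx); have [_ c0'] := chi_LC (LCx Ly).
by rewrite c0 c0' !zopE subr0 addr0.
Qed.

Lemma core_map_inj x y : inL x -> inL y -> phi x = phi y -> x = y.
Proof.
move=> Lx Ly exy; have Ex := inE_L HP Lx; have Ey := inE_L HP Ly.
have Ed := inE_lin HM HP (-1) Ex Ey.
have [_ cx] := chi_LC (LCx Lx); have [_ cy] := chi_LC (LCx Ly).
have [|_ + _] := chi_CE_inv Ed.
  split; first exact: chiE.
    by rewrite chi_lin // /= -/(phi x) -/(phi y) exy scaleN1r addNr.
  by rewrite chi_lin // /= cx cy scaler0 addr0.
by rewrite /= scaleN1r addrC => /eqP; rewrite subr_eq0 => /eqP.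
Qed.

Lemma core_map_surj y : inL' y -> exists x, inL x /\ phi x = y.
Proof.
move=> Ly; have Ey := inE_L HP' Ly; have [e [Ee eE]] := chi_surj Ey.
have LCe : inLC zeta D e by apply: chi_LC_inv => //; rewrite eE.
exists e.1.1; split; first by case: Ee.
by rewrite -core_mapE // eE.
Qed.

(** * Matching the weights of [H] and [H'] *)

Let supp := supportL zeta (M := M).
Let supp' := supportL zeta (M := M').

(** [p'] pulls back to [p] along [chi]. As a relation it can be built up on differences of roots,
    and it becomes a map because linear forms on [H] and [H'] determine the pairs. *)
Definition weights_match p p' :=
  forall e, inH zeta D e -> Hweight zeta p' (chi e) = Hweight zeta p e.

Let phi0 : phi 0 = 0.
Proof. by rewrite /core_map chi0. Qed.

Let phiZ a x : inL x -> phi (a *: x) = a *: phi x.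
Proof.
move=> Lx; have := core_map_lin a Lx (inL_lin zeta HM).1.
by rewrite phi0 !addr0.
Qed.

Lemma weights_match_root p p' x : weights_match p p' -> inL x ->
  Lroot zeta p x <-> Lroot zeta p' (phi x).
Proof.
move=> pp' Lx; have L0 := (inL_lin zeta HM).1.
have HwE := LrootP k_char0 zeta_prim HM HP; have HwE' := LrootP k_char0 zeta_prim HM' HP'.
split=> [/HwE[_ ex]|/HwE'[_ ex]].
  apply/HwE'; split; first exact: core_map_inL.
  by move=> e' /chiH_surj[e [He <-]]; rewrite -core_map_act // ex // phiZ // pp'.
apply/HwE; split=> // e He; have [Le _ De] := inH_inE HM He.
apply: core_map_inj.
- apply: (lin_closedD (inL_lin zeta HM)); first exact: (inL_brL zeta_prim HM).
  exact: (D_inL HM HP).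
- exact: (lin_closedZ (inL_lin zeta HM)).
- by rewrite core_map_act // phiZ // -pp' // ex //; exact: chiH.
Qed.

Lemma weights_match_eigen p p' x : x != 0 -> inL x ->
  Lroot zeta p x -> Lroot zeta p' (phi x) -> weights_match p p'.
Proof.
move=> xn0 Lx px p'x e He; have px' := LrootP k_char0 zeta_prim HM HP.
have yn0 : phi x != 0.
  by apply: contra_neq xn0 => e0; apply: core_map_inj => //; [exact: (inL_lin zeta HM).1 | rewrite phi0].
apply: (LT_scale_inj yn0).
have He' := chiH He.
rewrite -(Lroot_actE k_char0 zeta_prim HM' He' p'x) -core_map_act //.
by rewrite (Lroot_actE k_char0 zeta_prim HM He px) phiZ.
Qed.

Let weights_matchB p p' q q' : weights_match p p' -> weights_match q q' ->
  weights_match (p - q) (p' - q').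
Proof.
move=> pp qq e He; have := pp e He; rewrite -{1}(subrK q' p') -{1}(subrK q p).
by rewrite !HweightD qq // => /addIr.
Qed.

Let weights_match0 : weights_match 0 0.
Proof.
have H0 (M1 : mlData k n) (e : ET M1) : Hweight zeta 0 e = 0.
  by apply: (addIr (Hweight zeta 0 e)); rewrite -HweightD !add0r.
by move=> e He; rewrite !H0.
Qed.

(** For a root, the image of a root vector is a joint eigenvector of [H' = chi(H)], so it lies in a
    root space of [L']; matching pairs are closed under differences. *)
Lemma weights_match_exists p : gen_subgroup supp p ->
  exists p', gen_subgroup supp' p' /\ weights_match p p'.
Proof.
pose Q p := exists p', gen_subgroup supp' p' /\ weights_match p p'.
apply: (gen_subgroup_ind (Q := Q)).
- by exists 0; split; [exact: gen_subgroup0 | exact: weights_match0].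
- move=> q r [q' [Gq qq]] [r' [Gr rr]]; exists (q' - r').
  by split; [exact: gen_subgroupB | exact: weights_matchB].
move=> q [x [qx xn0]]; have Lx : inL x by case: qx => [[]].
have /eqP yn0 : phi x <> 0.
  by move=> e0; apply: xn0; apply: core_map_inj => //; [exact: (inL_lin zeta HM).1 | rewrite phi0].
have [|p' p'x] := Hweight_exists HM' HP' (core_map_inL Lx) yn0.
  move=> e' /chiH_surj[e [He <-]]; exists (Hweight zeta q e).
  by rewrite -core_map_act // (Lroot_actE k_char0 zeta_prim HM He qx) phiZ.
exists p'; split; last by apply: (weights_match_eigen _ Lx qx p'x); exact/eqP.
by apply: gen_subgroup_incl; exists (phi x); split=> //; exact/eqP.
Qed.

Lemma weights_match_exists_inv p' : gen_subgroup supp' p' ->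
  exists p, gen_subgroup supp p /\ weights_match p p'.
Proof.
pose Q p' := exists p, gen_subgroup supp p /\ weights_match p p'.
apply: (gen_subgroup_ind (Q := Q)).
- by exists 0; split; [exact: gen_subgroup0 | exact: weights_match0].
- move=> q' r' [q [Gq qq]] [r [Gr rr]]; exists (q - r).
  by split; [exact: gen_subgroupB | exact: weights_matchB].
move=> q' [y [qy yn0]]; have Ly : inL' y by case: qy => [[]].
have [x [Lx xy]] := core_map_surj Ly.
have /eqP xn0 : x <> 0 by move=> x0; apply: yn0; rewrite -xy x0 phi0.
rewrite -xy in qy.
have [|p px] := Hweight_exists HM HP Lx xn0.
  move=> e He; exists (Hweight zeta q' (chi e)); have [Le _ De] := inH_inE HM He.
  apply: core_map_inj.
  - apply: (lin_closedD (inL_lin zeta HM)); first exact: (inL_brL zeta_prim HM).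
    exact: (D_inL HM HP).
  - exact: (lin_closedZ (inL_lin zeta HM)).
  - rewrite core_map_act // phiZ //.
    exact: (Lroot_actE k_char0 zeta_prim HM' (chiH He) qy).
exists p; split; last exact: (weights_match_eigen xn0 Lx px qy).
by apply: gen_subgroup_incl; exists x; split=> //; exact/eqP.
Qed.

Lemma weights_match_uniq p p1 p2 : weights_match p p1 -> weights_match p p2 -> p1 = p2.
Proof.
move=> m1 m2; apply: (Hweight_inj k_char0 zeta_prim HM' HP') => _ /chiH_surj[e [He <-]].
by rewrite m1 // m2.
Qed.

Lemma weights_match_inj p q p' : weights_match p p' -> weights_match q p' -> p = q.
Proof.
move=> m1 m2; apply: (Hweight_inj k_char0 zeta_prim HM HP) => e He.
by rewrite -m1 // m2.
Qed.

Lemma chi_support_iso : support_iso zeta M M'.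
Proof.
have /choice[su suP] : forall p, exists p', gen_subgroup supp p ->
    gen_subgroup supp' p' /\ weights_match p p'.
  move=> p; have [/weights_match_exists[p' H]|np] := pselect (gen_subgroup supp p).
    by exists p'.
  (* A default value outside the generated subgroup, where nothing is required of the map on
     supports. *)
  by exists 0 => /np.
have genD p q : gen_subgroup supp p -> gen_subgroup supp q -> gen_subgroup supp (p + q).
  move=> Gp Gq; rewrite -[q]opprK -[- q]sub0r.
  by apply: gen_subgroupB => //; apply: gen_subgroupB => //; exact: gen_subgroup0.
exists phi, su; split; first split.
- exact: core_map_inL.
- exact: core_map_lin.
- exact: core_map_br.
- exact: core_map_inj.
- exact: core_map_surj.
- split.
  (* Additivity follows from uniqueness: [su p + su q] also matches [p + q]. *)
  + move=> p q Gp Gq; have [_ mpq] := suP _ (genD _ _ Gp Gq).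
    apply: (weights_match_uniq mpq) => e He.
    by rewrite !HweightD (suP p Gp).2 // (suP q Gq).2.
  + by move=> p /suP[].
  + move=> p q Gp Gq e; have [_ mp] := suP _ Gp; have [_ mq] := suP _ Gq.
    by apply: (weights_match_inj mp); rewrite e.
  + move=> p' /weights_match_exists_inv[p [Gp mp]]; exists p; split=> //.
    exact: (weights_match_uniq (suP _ Gp).2 mp).
- move=> p Gp; have [_ mp] := suP _ Gp; split.
    move=> x px; have Lx : inL x by case: px => [[]].
    exact/(weights_match_root mp Lx).
  move=> y py; have Ly : inL' y by case: py => [[]].
  have [x [Lx xy]] := core_map_surj Ly; exists x; split=> //.
  by apply/(weights_match_root mp Lx); rewrite xy.
Qed.
End Isomorphism.

Unset Implicit Arguments. Set Strict Implicit.

Theorem theorem5p2p10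
  (k : closedFieldType) (k_char0 : [pchar k] =i pred0)
  (zeta : nat -> k)
  (zeta_prim : forall N : nat, (0 < N)%N -> N.-primitive_root (zeta N))
  (zeta_compat : forall a b : nat, (0 < a)%N -> (0 < b)%N ->
                   zeta (a * b)%N ^+ a = zeta b)
  (n : nat) (M M' : mlData k n)
  (HM : is_mlData M) (HM' : is_mlData M')
  (Hfix : exists x : ml_g M, x != 0 /\ fixed_all x)
  (Hfix' : exists x : ml_g M', x != 0 /\ fixed_all x)
  (D : EndL M -> Prop) (tau : EndL M -> EndL M -> EndL M -> k)
  (D' : EndL M' -> Prop) (tau' : EndL M' -> EndL M' -> EndL M' -> k)
  (HP : inPL zeta D tau) (HP' : inPL zeta D' tau')
  (Hiso : eala_iso zeta D tau D' tau') :
  support_iso zeta M M'.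
Proof.
have [chi [[chiE chi_lin] chi_br [chi_inj chi_surj] [chiH chiH_surj] _]] := Hiso.
exact: (chi_support_iso k_char0 zeta_prim HM HM' HP HP' chiE chi_lin chi_br).
Qed.
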